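(* Let $F \colon M \times (-\infty,0) \to \mathbb{R}^{n+1}$ be a compact convex ancient mean curvature flow which at time $0$ becomes extinct at a point $p_\infty \in \mathbb{R}^{n+1}$, and let $\mathcal{R} := \bigcup_{t\in(-\infty,0)} F_t(M)$ be its set of reach. Then $\mathcal{R} \cup \{p_\infty\}$ is either a slab, a halfspace or all of $\mathbb{R}^{n+1}$.
   Context: Let $M = M^n$ be a smooth, connected (in particular nonempty) $n$-dimensional manifold without boundary, $n\ge 1$, and $I\subseteq\mathbb{R}$ an interval. A mean curvature flow is a smooth map $F \colon M \times I \to \mathbb{R}^{n+1}$ such that $F_t := F(\cdot,t) \colon M \to \mathbb{R}^{n+1}$ is an immersion for every $t \in I$ and $\frac{\partial F}{\partial t} = \overrightarrow{H}$, where $\overrightarrow{H}(x,t)$ is the mean curvature vector of the immersion $F_t$ at $x$ (the trace of the second fundamental form, equivalently the Laplacian of $F_t$ in the pullback metric). It is ancient if (after a time translation) $I = (-\infty, 0)$. The flow is compact if $M$ is compact, and convex if every time slice is a convex hypersurface: all principal curvatures are positive (for the suitable choice of unit normal) and $F_t(M)=\partial\Omega_t$ for a bounded strictly convex domain $\Omega_t\subseteq\mathbb{R}^{n+1}$. Becoming extinct at $p_\infty$ at time $0$ means that $F_t(M)$ shrinks to the point $p_\infty$ as $t\to 0^-$. A slab is the region between two distinct parallel affine hyperplanes and a halfspace is the region on one side of an affine hyperplane; here slabs and halfspaces are allowed to be open or closed. *)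

(* Defs.v *)
From HB Require Import structures.
From mathcomp Require Import all_boot all_order all_algebra.
From mathcomp Require Import all_classical all_reals all_analysis.

Set Implicit Arguments.
Unset Strict Implicit.
Unset Printing Implicit Defensive.

Import Order.TTheory GRing.Theory Num.Theory.
Import numFieldNormedType.Exports.

Local Open Scope classical_set_scope.
Local Open Scope ring_scope.

Section Smoothness.
Context {R : realType} {V W : normedModType R}.

Fixpoint iter_derive (f : V -> W) (vs : seq V) : V -> W :=
  if vs is v :: vs' then (fun x => 'D_v (iter_derive f vs') x) else f.

(* C^oo for open [U]: all iterated directional derivatives exist and are
   continuous at every point of [U]. *)
Definition smooth_on (U : set V) (f : V -> W) : Prop :=
  forall (vs : seq V) (x : V), U x ->
    {for x, continuous (iter_derive f vs)} /\
    forall v : V, derivable (iter_derive f vs) x v.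

End Smoothness.

(* The maps of a chart are total functions, relevant only on [chart_dom] and
   on its image. *)
Record chart (R : realType) (n : nat) (M : topologicalType) := Chart {
  chart_dom : set M ;
  chart_map : M -> 'rV[R]_n ;
  chart_inv : 'rV[R]_n -> M ;
  chart_dom_open : open chart_dom ;
  chart_img_open : open (chart_map @` chart_dom) ;
  chart_mapK : forall x, chart_dom x -> chart_inv (chart_map x) = x ;
  chart_map_cont : {within chart_dom, continuous chart_map} ;
  chart_inv_cont : {within chart_map @` chart_dom, continuous chart_inv}
}.

(* The atlas is not required to be maximal. *)
Record smooth_manifold (R : realType) (n : nat) := SmoothManifold {
  carrier :> topologicalType ;
  atlas : set (chart R n carrier) ;
  manifold_hausdorff : hausdorff_space carrier ;
  manifold_second_countable : @second_countable carrier ;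
  atlas_cover : \bigcup_(c in atlas) chart_dom c = [set: carrier] ;
  atlas_compat : forall c d, atlas c -> atlas d ->
    smooth_on (chart_map c @` (chart_dom c `&` chart_dom d))
      (chart_map d \o chart_inv c)
}.

Section EuclideanSpace.
Context {R : realType} {m : nat}.
Implicit Types (u v x y : 'rV[R]_m) (A : set 'rV[R]_m).

Definition dot u v : R := (u *m v^T) 0 0.

Definition boundary A : set 'rV[R]_m := closure A `\` A°.

Definition strictly_convex A : Prop :=
  forall x y (s : R), closure A x -> closure A y -> x != y -> 0 < s < 1 ->
    A° ((1 - s) *: x + s *: y).

Definition strictly_convex_domain A : Prop :=
  [/\ open A, A !=set0, connected A, bounded_set A & strictly_convex A].

Definition is_slab A : Prop :=
  exists (v : 'rV[R]_m) (a b : R), [/\ v != 0, a < b &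
    A = [set x | a < dot v x < b] \/ A = [set x | a <= dot v x <= b]].

Definition is_halfspace A : Prop :=
  exists (v : 'rV[R]_m) (a : R), v != 0 /\
    (A = [set x | dot v x < a] \/ A = [set x | dot v x <= a]).

End EuclideanSpace.

(* Extrinsic geometry of a parametrized hypersurface [X] of R^(n+1) at a
   parameter [u].  Since vectors are rows, row [i] of [jac] is the partial
   derivative of [X] along the [i]-th coordinate. *)
Section LocalGeometry.
Context {R : realType} {n : nat}.
Variables (X : 'rV[R]_n -> 'rV[R]_n.+1) (u : 'rV[R]_n).

Definition coord_vec (i : 'I_n) : 'rV[R]_n := delta_mx 0 i.

Definition jac : 'M[R]_(n, n.+1) := jacobian X u.

Definition first_ff : 'M[R]_n := jac *m jac^T.

Definition normal_part (w : 'rV[R]_n.+1) : 'rV[R]_n.+1 :=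
  w - w *m jac^T *m invmx first_ff *m jac.

Definition second_ff (i j : 'I_n) : 'rV[R]_n.+1 :=
  normal_part ('D_(coord_vec i) (fun z => 'D_(coord_vec j) X z) u).

Definition mean_curvature_vector : 'rV[R]_n.+1 :=
  \sum_(i < n) \sum_(j < n) invmx first_ff i j *: second_ff i j.

(* Matrix, acting on row vectors of coordinates, of the shape operator with
   respect to the unit normal [w]. *)
Definition shape_operator (w : 'rV[R]_n.+1) : 'M[R]_n :=
  (\matrix_(i < n, j < n) dot (second_ff i j) w) *m invmx first_ff.

Definition principal_curvature (w : 'rV[R]_n.+1) (k : R) : Prop :=
  eigenvalue (shape_operator w) k.

End LocalGeometry.

Section MeanCurvatureFlow.
Context {R : realType} {n : nat} {M : smooth_manifold R n}.
Implicit Types (c : chart R n M) (f : M -> 'rV[R]_n.+1).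

Definition local_rep f c : 'rV[R]_n -> 'rV[R]_n.+1 := f \o chart_inv c.

(* For [f] smooth: the differential is injective at every point. *)
Definition immersion f : Prop :=
  forall c x, atlas c -> chart_dom c x ->
    row_free (jac (local_rep f c) (chart_map c x)).

(* For [I] open. *)
Definition smooth_family (I : set R) (F : M -> R -> 'rV[R]_n.+1) : Prop :=
  forall c, atlas c ->
    smooth_on ((chart_map c @` chart_dom c) `*` I)
      (fun q : 'rV[R]_n * R => F (chart_inv c q.1) q.2).

Definition mean_curvature_flow (I : set R) (F : M -> R -> 'rV[R]_n.+1) : Prop :=
  [/\ smooth_family I F,
      (forall t, I t -> immersion (F^~ t)) &
      forall c x t, atlas c -> chart_dom c x -> I t ->
        derive1 (F x) t =
          mean_curvature_vector (local_rep (F^~ t) c) (chart_map c x)].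

Definition unit_normal f (nu : M -> 'rV[R]_n.+1) : Prop :=
  [/\ continuous nu,
      (forall x, dot (nu x) (nu x) = 1) &
      forall c x (i : 'I_n), atlas c -> chart_dom c x ->
        dot (nu x) (row i (jac (local_rep f c) (chart_map c x))) = 0].

Definition convex_hypersurface f : Prop :=
  (exists nu, unit_normal f nu /\
     forall c x (k : R), atlas c -> chart_dom c x ->
       principal_curvature (local_rep f c) (chart_map c x) (nu x) k -> 0 < k) /\
  (exists Omega : set 'rV[R]_n.+1,
     strictly_convex_domain Omega /\ range f = boundary Omega).

Definition ancient_flow (F : M -> R -> 'rV[R]_n.+1) : Prop :=
  mean_curvature_flow `]-oo, 0[ F.

Definition convex_ancient_flow (F : M -> R -> 'rV[R]_n.+1) : Prop :=
  ancient_flow F /\ forall t : R, t < 0 -> convex_hypersurface (F^~ t).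

(* The whole time slice converges to the point [p]. *)
Definition extinct_at (F : M -> R -> 'rV[R]_n.+1) (p : 'rV[R]_n.+1) : Prop :=
  forall e : R, 0 < e -> \forall t \near 0^'-, range (F^~ t) `<=` ball p e.

Definition set_of_reach (F : M -> R -> 'rV[R]_n.+1) : set 'rV[R]_n.+1 :=
  \bigcup_(t in `]-oo, (0 : R)[) range (F^~ t).

End MeanCurvatureFlow.

(* Main.v *)
Require Import Defs.
From HB Require Import structures.
From mathcomp Require Import all_boot all_order all_algebra.
From mathcomp Require Import all_classical all_reals all_analysis.
From mathcomp Require Import ring lra.
Import Order.TTheory GRing.Theory Num.Theory.
Import numFieldNormedType.Exports.
Set Implicit Arguments.
Unset Strict Implicit.
Unset Printing Implicit Defensive.
Local Open Scope classical_set_scope.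
Local Open Scope ring_scope.

(** The set of reach together with the extinction point is the union [U] of the
convex bodies bounded by the time slices. These bodies shrink as time goes on,
so [U] is an increasing union of convex sets, and it is to be shown that the
linear functionals bounded above on [U] are all multiples of a single one, and
that no nonzero functional attains its supremum on [U].

Everything about the flow itself comes from one maximum principle,
[cylinder_barrier]. For orthonormal [e], [e'], the squared distance [u] to an
affine subspace of codimension 2, [u = (e.F - a)^2 + (e'.F - b)^2], satisfies
[(d/dt - Laplacian) u = - 2 tr (P pi)], where [P] projects onto the tangent
space and [pi] onto the plane of [e] and [e']. At a spatial maximum with
[u > 0] the gradient of [u] is a normal vector lying in that plane, so the
trace is 1 ([projection_trace]) and [du/dt <= -2]
([mean_curvature_at_cylinder_max]). Hence the square of the radius of a
cylinder confining the flow may be decreased at unit speed. Moreover this may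
be done inside a region [rho <= 0] only, as long as the part of the flow on
[rho = 0] is known to stay inside the shrinking cylinder.

Three choices of cylinder give the geometry.
- Cylinders of radius tending to infinity: a halfspace containing a slice
  contains all later slices ([halfspace_preserved]), so the bodies are nested.
- A cylinder centred on the bisector of a wedge at distance [L] from the edge
  and passing through the edge: it shrinks until it touches the faces of the
  wedge, which takes time of order [L^2], and by then it has cleared a
  neighbourhood of the edge of size of order [L]. An ancient flow allows [L] to
  be arbitrarily large, so no such flow lives in a wedge ([no_planar_wedge],
  [no_wedge]). Thus the functionals bounded above on [U] are all parallel.
- A large cylinder almost tangent to a supporting hyperplane: by strict
  convexity a body meets that hyperplane in one point, and away from this point
  there is room to shrink the cylinder, which pushes the flow off the
  hyperplane at once ([support_not_attained]).

A point of a body is on the slice at the last time at which the bodies contain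
it, unless it is the extinction point ([hull_reached]). Finally a point outside
[U] is separated from [U] by a hyperplane ([unreached_separation]), and the
trichotomy is whether no functional, one functional up to positive factors, or
two opposite ones are bounded above on [U]. *)

(** * Functions with continuous partial derivatives *)

Lemma line_continuous (R : realType) (V : normedModType R) (x v : V) :
  {for 0, continuous (fun s : R => s *: v + x)}.
Proof.
apply: (@cvgD _ _ _ (nbhs (0 : R)) _ (fun s : R => s *: v) (cst x)).
  exact: scalel_continuous.
exact: cvg_cst.
Qed.

Lemma is_derive_line (R : realType) (V W : normedModType R) (f : V -> W)
    (x v : V) (s : R) :
  derivable f (s *: v + x) v ->
  is_derive s 1 (fun r => f (r *: v + x)) ('D_v f (s *: v + x)).
Proof.
have E : (fun h : R => h^-1 *: (f ((h *: 1 + s) *: v + x) - f (s *: v + x)))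
   = (fun h => h^-1 *: (f (h *: v + (s *: v + x)) - f (s *: v + x))).
  by apply/funext => h; rewrite [h%:A]mulr1 scalerDl addrA.
by move=> fd; split; rewrite /derivable/derive/= E.
Qed.

Lemma mvt_line (R : realType) (V : normedModType R) (f : V -> R)
    (x v : V) (c : R) :
  (forall s, `|s| <= `|c| -> derivable f (s *: v + x) v) ->
  exists2 s, `|s| <= `|c| & f (c *: v + x) - f x = c * 'D_v f (s *: v + x).
Proof.
move=> fd; pose g s := f (s *: v + x).
have gd (s : R) : `|s| <= `|c| -> is_derive s 1 g ('D_v f (s *: v + x)).
  by move=> /fd; exact: is_derive_line.
have g0 : g 0 = f x by rewrite /g scale0r add0r.
have cont a b : (forall s, s \in `[a, b] -> `|s| <= `|c|) ->
    {within `[a, b], continuous g}.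
  move=> ab; apply: derivable_within_continuous => s /ab /gd.
  by move=> [].
have [c0|c0] := leP 0 c.
- have ab (s : R) : s \in `[0, c] -> `|s| <= `|c|.
    by rewrite in_itv/= => /andP[s0 sc]; rewrite !ger0_norm.
  have [] := @MVT_segment R g (fun s => 'D_v f (s *: v + x)) 0 c c0.
  - by move=> s /subset_itv_oo_cc /ab /gd.
  - exact: cont.
  by move=> s /ab sc; rewrite g0 /g subr0 mulrC => ->; exists s.
- have ab (s : R) : s \in `[c, 0] -> `|s| <= `|c|.
    by rewrite in_itv/= => /andP[s0 sc]; rewrite !ler0_norm ?lerN2// ltW.
  have [] := @MVT_segment R g (fun s => 'D_v f (s *: v + x)) c 0 (ltW c0).
  - by move=> s /subset_itv_oo_cc /ab /gd.
  - exact: cont.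
  move=> s /ab sc; rewrite g0 /g sub0r => E; exists s => //.
  by rewrite -opprB E mulrN opprK mulrC.
Qed.

(** [f (z + h) - f z] is the sum of the increments along the coordinate
directions, moving one coordinate at a time; the mean value theorem turns each
of them into a partial derivative at a point close to [z]. *)
Lemma C1_differentiable_scalar (R : realType) (n : nat) (f : 'rV[R]_n -> R) z :
  (forall i, \forall y \near z, derivable f y (coord_vec i)) ->
  (forall i : 'I_n, {for z, continuous ('D_(coord_vec i) f)}) ->
  differentiable f z.
Proof.
move=> fd fc.
pose L (h : 'rV[R]_n) : R := \sum_(i < n) h 0 i * 'D_(coord_vec i) f z.
have Llin : linear L.
  move=> a h k; rewrite /L scaler_sumr -big_split/=; apply: eq_bigr => i _.
  by rewrite !mxE mulrDl scalerAl.
pose Lm := GRing.isLinear.Build R 'rV[R]_n R *:%R L Llin.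
pose LL : {linear 'rV[R]_n -> R} := HB.pack L Lm.
have LC : continuous LL.
  apply: continuous_big => [|i _ x]; first exact: add_continuous.
  have cc : {for x, continuous (fun h : 'rV[R]_n => h 0 i)}.
    exact: coord_continuous.
  exact: cvgMr_tmp cc.
suff E : f \o shift z = cst (f z) + LL +o_ 0 id.
  by apply/diff_locallyP; rewrite (diff_unique LC E).
apply/eqaddoP => _/posnumP[e].
have n1 : 0 < n.+1%:R :> R by [].
have : \forall y \near z, forall i, derivable f y (coord_vec i) /\
     `|'D_(coord_vec i) f z - 'D_(coord_vec i) f y| <= e%:num / n.+1%:R.
  have FF : Filter (nbhs z) by exact: nbhs_filter.
  apply: (@filter_forall _ _ _ _ FF) => i.
  apply: filterI (fd i) _.
  by have /cvgrPdist_le := fc i; apply; exact: divr_gt0.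
move=> /nbhs_ballP[d /= d0 dP].
near=> h.
have hd : `|h| < d.
  near: h; apply/nbhs_ballP; exists d => // h.
  by rewrite -ball_normE/= sub0r normrN.
(* the first [k] coordinates of the step [h] *)
pose hk (k : nat) : 'rV[R]_n := \row_j (if (j < k)%N then h 0 j else 0).
have -> : (f \o shift z - (cst (f z) + LL)) h = f (h + z) - f z - L h.
  by rewrite /= !fctE/= opprD addrA.
have hkn : hk n = h by apply/rowP => j; rewrite mxE ltn_ord.
have hk0 : hk 0%N = 0 by apply/rowP => j; rewrite !mxE.
have hkS (i : 'I_n) : hk i.+1 = h 0 i *: coord_vec i + hk i.
  apply/rowP => j; rewrite !mxE eqxx/= ltnS leq_eqVlt.
  have [->|ij] := eqVneq j i.
    by rewrite eqxx ltnn mulr1 addr0.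
  by rewrite (inj_eq val_inj) (negbTE ij)/= mulr0 add0r.
have -> : f (h + z) - f z = \sum_(i < n) (f (hk i.+1 + z) - f (hk i + z)).
  rewrite -(big_mkord xpredT (fun i => f (hk i.+1 + z) - f (hk i + z))).
  by rewrite (telescope_sumr (fun i => f (hk i + z)))// hkn hk0 add0r.
rewrite /L -sumrB.
apply: (le_trans (ler_norm_sum _ _ _)).
apply: (@le_trans _ _ (\sum_(i < n) (e%:num / n.+1%:R * `|h|))); last first.
  rewrite sumr_const card_ord -[leLHS]mulr_natr mulrAC; apply: ler_wpM2r => //.
  rewrite -mulrA ger_pMr// mulrC ler_pdivrMr// mul1r ler_nat//.
apply: ler_sum => i _.
have small (s : R) : `|s| <= `|h 0 i| -> ball z d (s *: coord_vec i + (hk i + z)).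
  move=> sh; rewrite -ball_normE/= addrA opprD addrCA subrr addr0 normrN.
  apply: le_lt_trans hd; rewrite [leLHS]/Num.Def.normr/= mx_normrE.
  apply: bigmax_le => // -[a j] _ /=; rewrite !mxE ord1 eqxx/=.
  apply: (@le_trans _ _ `|h 0 j|); last first.
    by rewrite [leRHS]/Num.Def.normr/= mx_normrE; exact: (le_bigmax _ _ (0, j)).
  have [->|ji] := eqVneq j i; first by rewrite ltnn mulr1 addr0.
  by rewrite mulr0 add0r; case: ifP => // _; rewrite normr0.
have [|s sh E] := @mvt_line R _ f (hk i + z) (coord_vec i) (h 0 i).
  by move=> s /small/dP/(_ i)[].
rewrite hkS -(addrA _ (hk i) z) E -mulrBr normrM mulrC.
apply: ler_pM => //.
  have [_] := dP _ (small _ sh) i.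
  by rewrite distrC.
by rewrite [leRHS]/Num.Def.normr/= mx_normrE; exact: (le_bigmax _ _ (0, i)).
Unshelve. all: by end_near. Qed.

(** The Jacobian matrix is defined from the total differential, whereas
smoothness is expressed by iterated directional derivatives; this is the bridge
between the two. *)
Lemma C1_differentiable (R : realType) (n m : nat) (f : 'rV[R]_n -> 'rV[R]_m) z :
  (forall i, \forall y \near z, derivable f y (coord_vec i)) ->
  (forall i : 'I_n, {for z, continuous ('D_(coord_vec i) f)}) ->
  differentiable f z.
Proof.
move=> fd fc.
have -> : f = fun y => \sum_(j < m) (f y 0 j *: delta_mx 0 j).
  by apply/funext => y; rewrite -row_sum_delta.
have -> : (fun y => \sum_(j < m) f y 0 j *: delta_mx 0 j) =
    \sum_(j < m) (fun y => f y 0 j *: delta_mx 0 j : 'rV[R]_m).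
  by apply/funext => y; rewrite fct_sumE.
apply: differentiable_sum => j.
apply: differentiableZl.
apply: C1_differentiable_scalar => i.
  by apply: filterS (fd i) => y /derivable_mxP.
have E : \forall y \near z,
    'D_(coord_vec i) f y 0 j = 'D_(coord_vec i) (fun y => f y 0 j) y.
  by apply: filterS (fd i) => y /derive_mx ->; rewrite mxE.
have c : {for z, continuous (fun y => 'D_(coord_vec i) f y 0 j)}.
  apply: (@continuous_comp _ _ _ _ (fun M : 'rV[R]_m => M 0 j) z (fc i)).
  exact: coord_continuous.
have /= Ez := nbhs_singleton E.
have FF : Filter (nbhs z) by exact: nbhs_filter.
rewrite /prop_for /continuous_at /= -Ez.
by apply: cvg_trans c; exact: (@near_eq_cvg _ _ _ FF).
Qed.

(** * The scalar product *)

Section Dot.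
Context {R : realType} {m : nat}.
Implicit Types (u v w : 'rV[R]_m).

Lemma dotE u v : dot u v = \sum_(i < m) u 0 i * v 0 i.
Proof. by rewrite /dot mxE; apply: eq_bigr => i _; rewrite mxE. Qed.

Lemma dotC u v : dot u v = dot v u.
Proof. by rewrite !dotE; apply: eq_bigr => i _; rewrite mulrC. Qed.

Lemma dotDr u v w : dot u (v + w) = dot u v + dot u w.
Proof. by rewrite /dot linearD/= mulmxDr mxE. Qed.

Lemma dotZr u (a : R) v : dot u (a *: v) = a * dot u v.
Proof. by rewrite /dot linearZ/= -scalemxAr mxE. Qed.

Lemma dotNr u v : dot u (- v) = - dot u v.
Proof. by rewrite -scaleN1r dotZr mulN1r. Qed.

Lemma dotBr u v w : dot u (v - w) = dot u v - dot u w.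
Proof. by rewrite dotDr dotNr. Qed.

Lemma dotDl u v w : dot (u + v) w = dot u w + dot v w.
Proof. by rewrite ![dot _ w]dotC dotDr. Qed.

Lemma dotZl (a : R) u v : dot (a *: u) v = a * dot u v.
Proof. by rewrite ![dot _ v]dotC dotZr. Qed.

Lemma dotNl u v : dot (- u) v = - dot u v.
Proof. by rewrite ![dot _ v]dotC dotNr. Qed.

Lemma dotBl u v w : dot (u - v) w = dot u w - dot v w.
Proof. by rewrite dotDl dotNl. Qed.

Lemma dot0r u : dot u 0 = 0.
Proof. by rewrite -(scale0r u) dotZr mul0r. Qed.

Lemma dot0l u : dot 0 u = 0.
Proof. by rewrite dotC dot0r. Qed.

Lemma dot_ge0 u : 0 <= dot u u.
Proof. by rewrite dotE sumr_ge0// => i _; rewrite -expr2 sqr_ge0. Qed.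

Lemma dot_eq0 u : (dot u u == 0) = (u == 0).
Proof.
apply/eqP/eqP => [|->]; last exact: dot0r.
rewrite dotE => /psumr_eq0P u0; apply/rowP => i; rewrite mxE.
have /eqP := u0 (fun i _ => sqr_ge0 (u 0 i)) i isT.
by rewrite mulf_eq0 orbb => /eqP.
Qed.

Lemma dot_gt0 u : u != 0 -> 0 < dot u u.
Proof. by move=> u0; rewrite lt_def dot_ge0 andbT dot_eq0. Qed.

Lemma dot_sumr I (r : seq I) (Q : pred I) u (V : I -> 'rV[R]_m) :
  dot u (\sum_(i <- r | Q i) V i) = \sum_(i <- r | Q i) dot u (V i).
Proof. by apply: big_morph; [exact: dotDr|exact: dot0r]. Qed.

Lemma dot_continuous u : continuous (dot u).
Proof.
rewrite (_ : dot u = fun v => \sum_(i < m) u 0 i * v 0 i); last first.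
  by apply/funext => v; rewrite dotE.
apply: continuous_big => [|i _ x]; first exact: add_continuous.
have cc : {for x, continuous (fun h : 'rV[R]_m => h 0 i)}.
  exact: coord_continuous.
exact: cvgMl_tmp cc.
Qed.

Lemma dist_dot_continuous u (c : R) : continuous (fun v => dot u v - c).
Proof.
move=> v; apply: (@cvgB _ _ _ (nbhs v) _ (dot u) (cst c)); last exact: cvg_cst.
exact: dot_continuous.
Qed.

Lemma sqr_dist_dot_continuous u (c : R) :
  continuous (fun v => (dot u v - c) ^+ 2).
Proof.
move=> v; have h : {for v, continuous (fun w => dot u w - c)}.
  exact: dist_dot_continuous.
exact: (cvgM h h).
Qed.

End Dot.

(** * The orthogonal projection onto the row space of a matrix *)

Section Gram.
Context {R : realType} {n : nat} (J : 'M[R]_(n, n.+1)).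
Hypothesis J_free : row_free J.

Let g := J *m J^T.
Let C := invmx g *m J.

Lemma gram_unit : g \in unitmx.
Proof.
rewrite -row_free_unit -kermx_eq0; apply/eqP/row_matrixP => i.
rewrite row0; set x := row i _.
have xg : x *m g = 0.
  by apply/sub_kermxP; rewrite /x row_sub.
have xJ : x *m J = 0.
  apply/eqP; rewrite -dot_eq0 /dot trmx_mul mulmxA -(mulmxA x) -/g xg.
  by rewrite mul0mx mxE.
by apply: (row_free_inj J_free); rewrite xJ mul0mx.
Qed.

Lemma gram_inv_sym : (invmx g)^T = invmx g.
Proof. by rewrite trmx_inv /g trmx_mul trmxK. Qed.

(** The inverse of the first fundamental form as a sum of squares: the rows of
[C^T] are the coordinates of the tangential projections of the standard basis
vectors. Contracting a bilinear form with the inverse metric thus amounts to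
summing its values on the diagonal over these rows. *)
Lemma gram_inv_factor : invmx g = C *m C^T.
Proof.
rewrite /C trmx_mul gram_inv_sym -mulmxA (mulmxA J) -/g.
by rewrite mulmxV ?gram_unit// mulmx1.
Qed.

Lemma sum_dot_projection (u : 'rV[R]_n.+1) :
  \sum_(k < n.+1) dot u (row k C^T *m J) ^+ 2 = dot (u *m J^T *m invmx g *m J) u.
Proof.
pose P := J^T *m invmx g *m J.
have PT : P^T = P by rewrite /P !trmx_mul trmxK gram_inv_sym mulmxA.
have PP : P *m P = P.
  rewrite /P !mulmxA -[_ *m J *m J^T]mulmxA -/g.
  by rewrite -[_ *m invmx g *m g]mulmxA mulVmx ?gram_unit// mulmx1.
have -> : u *m J^T *m invmx g *m J = u *m P by rewrite /P !mulmxA.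
transitivity (dot (u *m P) (u *m P)); last first.
  by rewrite /dot trmx_mul PT mulmxA -(mulmxA u) PP.
rewrite dotE; apply: eq_bigr => k _; rewrite -expr2; congr (_ ^+ 2).
rewrite -row_mul /C trmx_mul gram_inv_sym -/P /dot tr_row PT colE mulmxA.
by rewrite -colE mxE.
Qed.

Lemma normal_complement_sub (w f : 'rV[R]_n.+1) :
  w != 0 -> w *m J^T = 0 -> dot f w = 0 -> (f <= J)%MS.
Proof.
move=> w0 wJ fw.
have JK : (J <= kermx w^T)%MS.
  by apply/sub_kermxP; rewrite -[J]trmxK -trmx_mul wJ trmx0.
have fK : (f <= kermx w^T)%MS.
  by apply/sub_kermxP; apply/matrixP => i j; rewrite [RHS]mxE !ord1.
have rk : \rank J = \rank (kermx w^T).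
  rewrite mxrank_ker mxrank_tr rank_rV w0 subn1/=.
  exact/eqP.
apply: (submx_trans fK).
by have := mxrank_leqif_sup JK; rewrite rk => /geq_leqif; rewrite leqnn => <-.
Qed.

(** The left-hand side is the trace over the row space of [J] of the projection
onto the plane of [e] and [e']. This plane contains the normal vector
[w = a e + b e'], and its direction [f] orthogonal to [w] lies in the row space
of [J], which is a hyperplane: so [w] contributes 0 and [f] contributes 1. *)
Lemma projection_trace (e e' : 'rV[R]_n.+1) (a b : R) :
  dot e e = 1 -> dot e' e' = 1 -> dot e e' = 0 ->
  0 < a ^+ 2 + b ^+ 2 -> (a *: e + b *: e') *m J^T = 0 ->
  \sum_(k < n.+1) (dot e (row k C^T *m J) ^+ 2 +
                   dot e' (row k C^T *m J) ^+ 2) = 1.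
Proof.
move=> ee e'e' ee' ab; set w := _ + _ => wJ.
rewrite big_split/= !sum_dot_projection.
pose q u v := dot (u *m J^T *m invmx g *m J) v.
have qDl u v x : q (u + v) x = q u x + q v x by rewrite /q !mulmxDl dotDl.
have qZl c u x : q (c *: u) x = c * q u x by rewrite /q -!scalemxAl dotZl.
have qDr u v x : q x (u + v) = q x u + q x v by rewrite /q dotDr.
have qZr c u x : q x (c *: u) = c * q x u by rewrite /q dotZr.
have qC u v : q u v = q v u.
  by rewrite /q dotC /dot !trmx_mul trmxK gram_inv_sym !mulmxA.
rewrite -/(q e e) -/(q e' e').
pose f := - b *: e + a *: e'.
have ww : dot w w = a ^+ 2 + b ^+ 2.
  rewrite /w !dotDl !dotDr !dotZl !dotZr ee e'e' [dot e' e]dotC ee'; ring.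
have ff : dot f f = a ^+ 2 + b ^+ 2.
  rewrite /f !dotDl !dotDr !dotZl !dotZr ee e'e' [dot e' e]dotC ee'; ring.
have fw : dot f w = 0.
  rewrite /f /w !dotDl !dotDr !dotZl !dotZr ee e'e' [dot e' e]dotC ee'; ring.
have w0 : w != 0 by rewrite -dot_eq0 ww gt_eqF.
have qw : q w w = 0 by rewrite /q wJ !mul0mx dot0l.
have qf : q f f = a ^+ 2 + b ^+ 2.
  have /submxP[y fy] := normal_complement_sub w0 wJ fw.
  rewrite -ff /q {1}fy -[y *m J *m J^T]mulmxA -/g.
  by rewrite -(mulmxA y) mulmxV ?gram_unit// mulmx1 -fy.
have : q w w + q f f = (a ^+ 2 + b ^+ 2) * (q e e + q e' e').
  rewrite /w /f !qDl !qDr !qZl !qZr (qC e' e); ring.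
rewrite qw qf add0r -{1}[_ + b ^+ 2]mulr1 => /(mulfI (lt0r_neq0 ab)) <-.
by [].
Qed.

End Gram.

(** * Second order conditions at a maximum *)

Lemma smooth_on_derive (R : realType) (V W : normedModType R) (U : set V)
    (f : V -> W) v :
  smooth_on U f -> smooth_on U ('D_v f).
Proof.
move=> fs vs.
have -> : iter_derive ('D_v f) vs = iter_derive f (rcons vs v).
  by elim: vs => //= a vs ->.
exact: fs.
Qed.

Lemma smooth_on_differentiable (R : realType) (n m : nat) (U : set 'rV[R]_n)
    (X : 'rV[R]_n -> 'rV[R]_m) z :
  open U -> smooth_on U X -> U z -> differentiable X z.
Proof.
move=> oU Xs Uz; apply: C1_differentiable => i.
  have : \forall y \near z, U y by exact: open_nbhs_nbhs.
  by apply: filterS => y Uy; have [_] := Xs [::] y Uy; exact.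
by have [] := Xs [:: coord_vec i] z Uz.
Qed.

Lemma derive_slice (R : realType) (V W : normedModType R) (f : V * R -> W)
    (t : R) (v z : V) :
  (derivable f (z, t) (v, 0) -> derivable (fun y => f (y, t)) z v) /\
  'D_v (fun y => f (y, t)) z = 'D_(v, 0) f (z, t).
Proof.
have E : (fun h : R => h^-1 *: (f (h *: v + z, t) - f (z, t))) =
         (fun h : R => h^-1 *: (f (h *: (v, 0) + (z, t)) - f (z, t))).
  apply/funext => h; congr (_ *: (f _ - _)).
  by rewrite /GRing.add/= /add_pair/= scaler0 add0r.
by split; rewrite /derivable /derive /= E.
Qed.

Lemma smooth_on_slice (R : realType) (V W : normedModType R) (U : set V)
    (I : set R) (f : V * R -> W) t :
  smooth_on (U `*` I) f -> I t -> smooth_on U (fun z => f (z, t)).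
Proof.
move=> fs It vs x Ux.
have E us : iter_derive (fun z => f (z, t)) us =
    fun z => iter_derive f [seq (v, 0) | v <- us] (z, t).
  elim: us => //= v us ->; apply/funext => z.
  exact: (derive_slice _ _ _ _).2.
have [fc fd] := fs [seq (v, 0) | v <- vs] (x, t) (conj Ux It).
rewrite E; split => [|v]; last exact/(derive_slice _ _ _ _).1/fd.
apply: (@continuous_comp _ _ _ (fun z => (z, t)) (iter_derive f _) x _ fc).
exact: (cvg_pair (@cvg_id _ (nbhs x)) (cvg_cst t)).
Qed.

Lemma second_derivative_max (R : realType) (V : normedModType R) (f : V -> R)
    (z v : V) :
  (\forall y \near z, derivable f y v) -> derivable ('D_v f) z v ->
  (\forall y \near z, f y <= f z) ->
  'D_v f z = 0 /\ 'D_v ('D_v f) z <= 0.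
Proof.
move=> fd fdd fmax.
have [d /= d0 dP] : exists2 d : R, 0 < d & forall s : R, `|s| < d ->
    derivable f (s *: v + z) v /\ f (s *: v + z) <= f z.
  have : \forall s \near (0 : R),
      derivable f (s *: v + z) v /\ f (s *: v + z) <= f z.
    apply: (@line_continuous _ _ z v (fun y => derivable f y v /\ f y <= f z)).
    by rewrite /= scale0r add0r; exact: filterI.
  move=> /nbhs_ballP[d /= d0 dP]; exists d => // s sd.
  by apply: dP; rewrite -ball_normE/= sub0r normrN.
pose g (s : R) := f (s *: v + z).
have gd (s : R) : `|s| < d -> is_derive s 1 g ('D_v f (s *: v + z)).
  by move=> /dP[? _]; exact: is_derive_line.
have sd (s : R) : s \in `]-d, d[ -> `|s| < d by rewrite in_itv/= ltr_norml.
have D0 : 'D_v f z = 0.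
  have g0 : is_derive (0 : R) (1 : R) g 0.
    apply: (@derive1_at_max _ g (- d) d).
    - by rewrite ge0_cp// ltW.
    - by move=> s /sd/gd[].
    - by rewrite in_itv/= oppr_lt0 d0.
    - by move=> s /sd/dP[_]; rewrite /g scale0r add0r.
  have [_ <-] := g0; have n0 : `|0 : R| < d by rewrite normr0.
  by have [_ ->] := gd _ n0; rewrite scale0r add0r.
split => //; rewrite leNgt; apply/negP => pos.
have /cvgrPdist_lt/(_ _ pos)/= [r /= r0 rP] := fdd.
pose c := Num.min r d / 2.
have m0 : 0 < Num.min r d by rewrite lt_min r0 d0.
have c0 : 0 < c by rewrite divr_gt0.
have cm : c < Num.min r d by rewrite ltr_pdivrMr// ltr_pMr// ltr1n.
have [cr cd] : c < r /\ c < d by apply/andP; rewrite -lt_min.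
have [|| s] := @MVT R g (fun s => 'D_v f (s *: v + z)) 0 c c0.
- move=> s; rewrite in_itv/= => /andP[s0 sc]; apply: gd.
  by rewrite gtr0_norm// (lt_trans sc).
- apply: derivable_within_continuous => s; rewrite in_itv/= => /andP[s0 sc].
  have [|//] := gd s.
  by rewrite ger0_norm// (le_lt_trans sc).
rewrite in_itv/= => /andP[s0 sc] E.
(* on a short segment the first derivative is close to [s] times the second *)
have Dpos : 0 < 'D_v f (s *: v + z).
  have sr : ball_ Num.norm 0 r s.
    by rewrite /ball_/= sub0r normrN gtr0_norm// (lt_trans sc).
  have /= := rP s sr (lt0r_neq0 s0).
  rewrite -/('D_v ('D_v f) z) D0 subr0 ltr_distlC subrr => /andP[+ _].
  by rewrite /GRing.scale/= pmulr_rgt0// invr_gt0.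
have : 0 < g c - g 0 by rewrite E subr0 mulr_gt0.
rewrite subr_gt0 /g scale0r add0r; apply/negP; rewrite -leNgt.
by have [|//] := dP c; rewrite gtr0_norm.
Qed.

Lemma is_derive_dot (R : realType) (V : normedModType R) (m : nat)
    (e : 'rV[R]_m) (X : V -> 'rV[R]_m) (y a : V) :
  derivable X y a -> is_derive y a (fun y => dot e (X y)) (dot e ('D_a X y)).
Proof.
move=> Xd.
have L : (fun h : R => h^-1 *: (dot e (X (h *: a + y)) - dot e (X y))) @ 0^' -->
    dot e ('D_a X y).
  rewrite (_ : (fun h : R => _) =
      dot e \o (fun h : R => h^-1 *: (X (h *: a + y) - X y))); last first.
    by apply/funext => h; rewrite /= dotZr dotBr.
  exact: cvg_comp Xd (@dot_continuous _ _ e _).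
split; first by apply/cvg_ex; eexists; exact: L.
by apply: cvg_lim => //; exact: L.
Qed.

Lemma derive_coord (R : realType) (n m : nat) (X : 'rV[R]_n -> 'rV[R]_m) y a :
  differentiable X y -> 'D_a X y = \sum_i a 0 i *: 'D_(coord_vec i) X y.
Proof.
move=> Xd; rewrite deriveEjacobian// mulmx_sum_row; apply: eq_bigr => i _.
by rewrite deriveEjacobian// rowE.
Qed.

Section CylinderTest.
Context {R : realType} {n : nat}.
Variables (U : set 'rV[R]_n) (X : 'rV[R]_n -> 'rV[R]_n.+1) (z : 'rV[R]_n).
Hypotheses (oU : open U) (Xs : smooth_on U X) (Uz : U z).

Let nearU : \forall y \near z, U y.
Proof. exact: open_nbhs_nbhs. Qed.

Lemma derive2_coord a :
  'D_a ('D_a X) z = \sum_i \sum_j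
     (a 0 i * a 0 j) *: 'D_(coord_vec i) ('D_(coord_vec j) X) z.
Proof.
have E : \forall y \near z, 'D_a X y = (\sum_j (a 0 j *: 'D_(coord_vec j) X)) y.
  apply: filterS nearU => y Uy.
  rewrite derive_coord ?fct_sumE//; exact: smooth_on_differentiable Xs Uy.
have Dd j v : derivable ('D_(coord_vec j) X) z v.
  by have [_] := Xs [:: coord_vec j] Uz; exact.
rewrite (near_eq_derive _ E) derive_sum; last first.
  by move=> j; apply: derivableZ.
rewrite exchange_big/=; apply: eq_bigr => j _.
rewrite deriveZ// derive_coord; last first.
  by apply: (smooth_on_differentiable oU) Uz; exact: smooth_on_derive.
by rewrite scaler_sumr; apply: eq_bigr => i _; rewrite scalerA mulrC.
Qed.

Lemma dot_normal_part (w y : 'rV[R]_n.+1) :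
  w *m (jac X z)^T = 0 -> dot w (normal_part X z y) = dot w y.
Proof.
move=> wJ; rewrite /normal_part dotBr.
have -> : dot w (y *m (jac X z)^T *m invmx (first_ff X z) *m jac X z) = 0.
  by rewrite /dot trmx_mul mulmxA wJ mul0mx mxE.
by rewrite subr0.
Qed.

Variables (e e' : 'rV[R]_n.+1) (a b : R).
Hypotheses (ee : dot e e = 1) (ee' : dot e' e' = 1) (eo : dot e e' = 0).
Let s y := dot e (X y) - a.
Let s' y := dot e' (X y) - b.

(** At a maximum of [s^2 + s'^2] the vector [w = s e + s' e'] is normal, so that
[w.H] is the contraction of the Hessian of [X], paired with [w], with the
inverse metric. The second order condition along [v] bounds [w.D_v D_v X] by
minus the squared length of the component of [D_v X] in the plane of [e] and
[e'], and these squared lengths add up to 1. *)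
Lemma mean_curvature_at_cylinder_max :
  row_free (jac X z) -> 0 < s z ^+ 2 + s' z ^+ 2 ->
  (\forall y \near z, s y ^+ 2 + s' y ^+ 2 <= s z ^+ 2 + s' z ^+ 2) ->
  s z * dot e (mean_curvature_vector X z) +
  s' z * dot e' (mean_curvature_vector X z) <= - 1.
Proof.
move=> Jf pos zmax.
pose psi := (s * s + s' * s' : _ -> R).
have Xd y v : U y -> derivable X y v by move=> Uy; have [_] := Xs [::] Uy; exact.
have DXd u y v : U y -> derivable ('D_u X) y v.
  by move=> Uy; have [_] := Xs [:: u] Uy; exact.
have sd y v : U y -> is_derive y v s (dot e ('D_v X y)).
  move=> Uy; have h := is_derive_dot e (Xd y v Uy).
  by apply: is_derive_eq; rewrite subr0.
have s'd y v : U y -> is_derive y v s' (dot e' ('D_v X y)).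
  move=> Uy; have h := is_derive_dot e' (Xd y v Uy).
  by apply: is_derive_eq; rewrite subr0.
have psid y v : U y -> is_derive y v psi
    (2 * (s y * dot e ('D_v X y) + s' y * dot e' ('D_v X y))).
  move=> Uy; have h := sd _ v Uy; have h' := s'd _ v Uy.
  apply: (is_derive_eq (is_deriveD (is_deriveM h h) (is_deriveM h' h'))).
  rewrite /GRing.scale/=; move: (s y) (s' y) (dot e _) (dot e' _).
  by move=> *; ring.
pose w := s z *: e + s' z *: e'.
have test v : dot w ('D_v X z) = 0 /\
    dot e ('D_v X z) ^+ 2 + dot e' ('D_v X z) ^+ 2 + dot w ('D_v ('D_v X) z) <= 0.
  pose dpsi := (2 \*: (s * (fun y => dot e ('D_v X y)) +
                  s' * (fun y => dot e' ('D_v X y))) : 'rV[R]_n -> R)%R.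
  have E : \forall y \near z, dpsi y = 'D_v psi y.
    by apply: filterS nearU => y Uy; have [_ ->] := psid y v Uy.
  have dd : is_derive z v dpsi (2 * (dot e ('D_v X z) ^+ 2 +
      dot e' ('D_v X z) ^+ 2 + dot w ('D_v ('D_v X) z))).
    have h := sd _ v Uz; have h' := s'd _ v Uz.
    have k := is_derive_dot e (DXd v z v Uz).
    have k' := is_derive_dot e' (DXd v z v Uz).
    apply: (is_derive_eq
      (is_deriveZ 2 (is_deriveD (is_deriveM h k) (is_deriveM h' k')))).
    rewrite /GRing.scale/= /w dotDl !dotZl.
    move: (s z) (s' z) (dot e _) (dot e' _) (dot e _) (dot e' _).
    by move=> *; ring.
  have [|||D0 DD] := @second_derivative_max _ _ psi z v.
  - by apply: filterS nearU => y Uy; have [] := psid y v Uy.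
  - by have [] := near_eq_is_derive E dd.
  - by apply: filterS zmax => y; rewrite /psi /= !fctE -!expr2.
  split.
    have [_ h] := psid z v Uz; move: D0; rewrite h /w dotDl !dotZl.
    by move=> /eqP; rewrite mulf_eq0 pnatr_eq0/= => /eqP.
  by have [_ h] := near_eq_is_derive E dd; move: DD; rewrite h pmulr_rle0.
have DJ v : 'D_v X z = v *m jac X z.
  by rewrite deriveEjacobian//; exact: smooth_on_differentiable Xs Uz.
have wJ : w *m (jac X z)^T = 0.
  apply/rowP => i; rewrite [RHS]mxE -[RHS](test (coord_vec i)).1 DJ.
  by rewrite /coord_vec -rowE /dot tr_row colE mulmxA -colE [RHS]mxE.
set C := invmx (first_ff X z) *m jac X z.
have tr := projection_trace Jf ee ee' eo pos wJ; rewrite -/C in tr.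
have -> : s z * dot e (mean_curvature_vector X z) +
  s' z * dot e' (mean_curvature_vector X z) = dot w (mean_curvature_vector X z).
  by rewrite /w dotDl !dotZl.
have -> : dot w (mean_curvature_vector X z) =
    \sum_(k < n.+1) dot w ('D_(row k C^T) ('D_(row k C^T) X) z).
  under [RHS]eq_bigr => k _.
    rewrite derive2_coord dot_sumr.
    under eq_bigr => i _ do rewrite dot_sumr.
    over.
  rewrite /mean_curvature_vector dot_sumr exchange_big; apply: eq_bigr => i _.
  rewrite dot_sumr exchange_big; apply: eq_bigr => j _.
  rewrite dotZr /second_ff dot_normal_part// gram_inv_factor// -/C mxE mulr_suml.
  by apply: eq_bigr => k _; rewrite dotZr !mxE.
rewrite -tr -sumrN; apply: ler_sum => k _.
by have [_] := test (row k C^T); rewrite DJ lerNr -subr_le0 opprK addrC.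
Qed.

End CylinderTest.

(** * The maximum principle *)

Lemma left_max_derive_ge0 (R : realType) (g : R -> R) (t D : R) :
  is_derive t 1 g D -> (\forall r \near t^'-, g r <= g t) -> 0 <= D.
Proof.
move=> [gd gD] gmax; rewrite leNgt; apply/negP => Dneg.
have D0 : 0 < - 'D_1 g t by rewrite gD oppr_gt0.
have /cvgrPdist_lt/(_ _ D0)/= [r /= r0 rP] := gd.
move: gmax => [d /= d0 dP].
pose c := Num.min r d / 2.
have m0 : 0 < Num.min r d by rewrite lt_min r0 d0.
have c0 : 0 < c by rewrite divr_gt0.
have cm : c < Num.min r d by rewrite ltr_pdivrMr// ltr_pMr// ltr1n.
have [cr cd] : c < r /\ c < d by apply/andP; rewrite -lt_min.
have gle : g (t - c) <= g t.
  apply: dP; last by rewrite ltrBlDr ltrDl.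
  by rewrite /ball_/= opprB addrC subrK gtr0_norm.
have rc : ball_ Num.norm 0 r (- c) by rewrite /ball_/= sub0r opprK gtr0_norm.
have nc : - c != 0 by rewrite oppr_eq0 gt_eqF.
have /= := rP _ rc nc; rewrite -/('D_1 g t).
rewrite ltr_distlC => /andP[_]; rewrite subrr [(- c)%:A]mulr1 [- c + t]addrC.
rewrite /GRing.scale/= invrN mulNr oppr_lt0 pmulr_rgt0 ?invr_gt0//.
by rewrite subr_gt0 ltNge gle.
Qed.

Section Flow.
Context {R : realType} {n : nat} {M : smooth_manifold R n}.
Variable F : M -> R -> 'rV[R]_n.+1.
Hypothesis F_flow : ancient_flow F.

Lemma chart_at (x : M) : exists2 c, @atlas R n M c & chart_dom c x.
Proof.
have : [set: M] x by [].
by rewrite -(@atlas_cover R n M) => -[c ca cx]; exists c.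
Qed.

Let neg (t : R) : t < 0 -> (`]-oo, (0 : R)[%classic) t.
Proof. by rewrite /= in_itv. Qed.

Lemma flow_continuous (x : M) (t : R) : t < 0 ->
  {for (x, t), continuous (fun q : M * R => F q.1 q.2)}.
Proof.
move=> t0; have [c ca cx] := chart_at x; have [Fs _ _] := F_flow.
pose f (q : 'rV[R]_n * R) := F (chart_inv c q.1) q.2.
have fc : {for (chart_map c x, t), continuous f}.
  have [|h _] := Fs c ca [::] (chart_map c x, t); last exact: h.
  by split; [exists x|exact: neg].
have mc : {for x, continuous (chart_map c)}.
  have := @chart_map_cont _ _ _ c.
  rewrite continuous_open_subspace; last exact: chart_dom_open.
  by apply; rewrite inE.
pose k (q : M * R) := (chart_map c q.1, q.2).
have kc : {for (x, t), continuous k}.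
  have mfc : {for (x, t), continuous (chart_map c \o fst : M * R -> _)}.
    by apply: continuous_comp mc; exact: cvg_fst.
  exact: cvg_pair mfc cvg_snd.
have fk : {for (x, t), continuous (f \o k)} by exact: continuous_comp kc fc.
have E : \forall q \near (x, t), f (k q) = F q.1 q.2.
  exists (chart_dom c, setT) => /= [|[y r] [/= cy _]].
    split; last exact: filterT.
    by apply: open_nbhs_nbhs; split => //; exact: chart_dom_open.
  by rewrite /f /k /= chart_mapK.
rewrite /prop_for /continuous_at -(nbhs_singleton E).
have FF : Filter (nbhs (x, t)) by exact: nbhs_filter.
by apply: cvg_trans fk; exact: (@near_eq_cvg _ _ _ FF).
Qed.

Lemma flow_derive (c : chart R n M) (x : M) (t : R) :
  atlas c -> chart_dom c x -> t < 0 ->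
  is_derive t 1 (F x)
    (mean_curvature_vector (local_rep (F^~ t) c) (chart_map c x)).
Proof.
move=> ca cx t0; have [Fs _ FH] := F_flow.
rewrite -(FH c x t ca cx (neg t0)) derive1E; apply: derivableP.
pose f (q : 'rV[R]_n * R) := F (chart_inv c q.1) q.2.
have [|_ h] := Fs c ca [::] (chart_map c x, t).
  by split; [exists x|exact: neg].
have := h (0, 1); rewrite /derivable /=.
rewrite (_ : (fun h : R => _) =
    (fun h : R => h^-1 *: (F x (h *: 1 + t) - F x t)))//.
by apply/funext => r; rewrite /f /= scaler0 add0r chart_mapK.
Qed.

Hypothesis M_compact : compact [set: M].

(** Avoidance principle: [C] is the square of the initial radius of a cylinder,
and the squared radius decreases at half the rate which
[mean_curvature_at_cylinder_max] allows; the slack makes the maximum argument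
strict. If [u + t] exceeded its bound [C + t1] somewhere on the part of the flow
in the region [rho <= 0], its maximum would be attained after time [t1] and in
the interior of the region, with [u > 0] because [t2 - t1 <= C], and there [u]
decreases at rate 2, which is absurd. *)
Lemma cylinder_barrier (e e' : 'rV[R]_n.+1) (a b C t1 t2 : R)
    (rho : 'rV[R]_n.+1 -> R)
    (u := fun y => (dot e y - a) ^+ 2 + (dot e' y - b) ^+ 2) :
  dot e e = 1 -> dot e' e' = 1 -> dot e e' = 0 ->
  continuous rho -> t1 <= t2 -> t2 < 0 -> t2 - t1 <= C ->
  (forall x, rho (F x t1) <= 0 -> u (F x t1) <= C) ->
  (forall x t, t1 <= t <= t2 -> rho (F x t) = 0 -> u (F x t) <= C - (t - t1)) ->
  forall x, rho (F x t2) <= 0 -> u (F x t2) <= C - (t2 - t1).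
Proof.
move=> ee ee' eo rhoc t12 t20 tC init side x1 rx1.
rewrite leNgt; apply/negP => bad.
(* Stopping the time at [t2] makes the flow continuous on the whole product, so
   that closedness and compactness need no relative versions. *)
pose G (q : M * R) := F q.1 (Num.min q.2 t2).
have Gc : continuous G.
  move=> [x t].
  have mc : {for (x, t), continuous (fun q : M * R => Num.min q.2 t2)}.
    by apply: continuous_min; [exact: cvg_snd|exact: cvg_cst].
  apply: (@continuous_comp _ _ _ (fun q : M * R => (q.1, Num.min q.2 t2))
    (fun q : M * R => F q.1 q.2) (x, t)); first exact: cvg_pair cvg_fst mc.
  by apply: flow_continuous; rewrite gt_min t20 orbT.
have uc : continuous u.
  move=> y; apply: (@cvgD _ _ _ (nbhs y) _ (fun y => (dot e y - a) ^+ 2)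
    (fun y => (dot e' y - b) ^+ 2)); exact: sqr_dist_dot_continuous.
pose phi q := u (G q) + q.2.
have phic : continuous phi.
  move=> q; apply: (@cvgD _ _ _ (nbhs q) _ (u \o G) snd); last exact: cvg_snd.
  by apply: continuous_comp; [exact: Gc|exact: uc].
pose A := ([set: M] `*` `[t1, t2]) `&` [set q | rho (G q) <= 0].
have Ac : compact A.
  apply: compact_closedI.
    by apply: compact_setX => //; exact: segment_compact.
  apply: (@preimage_closed _ _ (rho \o G) [set r | r <= 0]); last exact: closed_le.
  by move=> q _; apply: continuous_comp; [exact: Gc|exact: rhoc].
have GE x t : t <= t2 -> G (x, t) = F x t by move=> tt; rewrite /G /= min_l.
have A1 : A (x1, t2).
  by split; [split => //=; rewrite in_itv/= t12 lexx|rewrite /= GE].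
have [|q0] := compact_EVT_max _ Ac (continuous_subspaceT phic).
  by exists (x1, t2).
case: q0 => x0 t0; rewrite inE => -[[_ /=]]; rewrite in_itv/= => /andP[t10 t02].
rewrite GE// => rx0 qmax.
have max x t : t1 <= t <= t2 -> rho (F x t) <= 0 ->
    u (F x t) + t <= u (F x0 t0) + t0.
  move=> /andP[tt1 tt2] r; have := qmax (x, t); rewrite /phi !GE//=; apply.
  by rewrite inE; split; [split => //=; rewrite in_itv/= tt1|rewrite /= GE].
have big : C < u (F x0 t0) + (t0 - t1).
  have := max x1 t2; rewrite t12 lexx => /(_ isT rx1); move: bad; rewrite /u; lra.
have t10' : t1 < t0.
  rewrite lt_neqAle t10 andbT; apply/eqP => tE.
  by move: big; rewrite -tE subrr addr0 ltNge init// tE.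
have rx0' : rho (F x0 t0) < 0.
  rewrite lt_neqAle rx0 andbT; apply/eqP => rE.
  by have := side x0 t0; rewrite t10 t02 => /(_ isT rE); lra.
have t00 : t0 < 0 by exact: le_lt_trans t20.
have [c ca cx] := chart_at x0.
pose z := chart_map c x0; pose X := local_rep (F^~ t0) c.
pose U := chart_map c @` chart_dom c.
have oU : open U by exact: chart_img_open.
have Uz : U z by exists x0.
have [Fs Fi _] := F_flow.
have Xs : smooth_on U X by exact: smooth_on_slice (Fs c ca) (neg t00).
have Xz : X z = F x0 t0 by rewrite /X /local_rep /= chart_mapK.
have Xc : {for z, continuous X} by have [] := Xs [::] z Uz.
have Hle : (dot e (X z) - a) * dot e (mean_curvature_vector X z) +
  (dot e' (X z) - b) * dot e' (mean_curvature_vector X z) <= - 1.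
  apply: (mean_curvature_at_cylinder_max oU Xs Uz ee ee' eo).
  - exact: (Fi _ (neg t00) c x0 ca cx).
  - rewrite Xz -/(u (F x0 t0)); lra.
  - have nU : \forall y \near z, U y by exact: open_nbhs_nbhs.
    have nr : \forall y \near z, rho (X y) < 0.
      have rXc : {for z, continuous (rho \o X)}.
        by apply: continuous_comp; [exact: Xc|exact: rhoc].
      apply: (rXc [set r | r < 0]).
      apply: open_nbhs_nbhs; split; first exact: open_lt.
      by rewrite /= Xz.
    apply: filterS (filterI nU nr) => y [[x' cx' <-]].
    rewrite Xz {1 2}/X /local_rep /= chart_mapK// => r.
    have := max x' t0; rewrite t10 t02 => /(_ isT (ltW r)).
    by rewrite lerD2r; rewrite /X /local_rep /= chart_mapK.
pose s t := dot e (F x0 t) - a; pose s' t := dot e' (F x0 t) - b.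
have [Fd FD] := flow_derive ca cx t00.
have h0 := is_derive_dot e Fd; have h0' := is_derive_dot e' Fd.
have h : is_derive t0 1 s (dot e ('D_1 (F x0) t0)).
  by apply: is_derive_eq; rewrite subr0.
have h' : is_derive t0 1 s' (dot e' ('D_1 (F x0) t0)).
  by apply: is_derive_eq; rewrite subr0.
have gd := is_deriveD (is_deriveD (is_deriveM h h) (is_deriveM h' h'))
   (is_derive_id t0 1).
have ge0 := left_max_derive_ge0 gd.
suff /ge0 : \forall r \near t0^'-, (s * s + s' * s' + id) r <=
    (s * s + s' * s' + id) t0.
  move: Hle; rewrite FD Xz /GRing.scale/= -/(s t0) -/(s' t0).
  move: (mean_curvature_vector _ _) => H; lra.
have Fc : {for t0, continuous (F x0)}.
  by apply/differentiable_continuous/derivable1_diffP.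
have nr : \forall r \near t0, rho (F x0 r) < 0.
  have rFc : {for t0, continuous (rho \o F x0)}.
    by apply: continuous_comp; [exact: Fc|exact: rhoc].
  apply: (rFc [set r | r < 0]).
  by apply: open_nbhs_nbhs; split; first exact: open_lt.
near=> r.
have rt0 : r < t0 by near: r; exact: nbhs_left_lt.
have t1r : t1 < r by near: r; exact: nbhs_left_gt.
have rr : rho (F x0 r) < 0 by near: r; exact: cvg_within nr.
rewrite !fctE -!expr2.
apply: max; last exact: ltW.
by rewrite (ltW t1r) (ltW (lt_le_trans rt0 t02)).
Unshelve. all: by end_near. Qed.

End Flow.

(** * Strictly convex domains and hulls *)

Lemma exists_unit_multiple (R : realType) (m : nat) (v : 'rV[R]_m) :
  v != 0 -> exists2 r : R, 0 < r & dot (r *: v) (r *: v) = 1.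
Proof.
move=> /dot_gt0 v0; exists (Num.sqrt (dot v v))^-1.
  by rewrite invr_gt0 sqrtr_gt0.
rewrite dotZl dotZr mulrA -expr2 exprVn sqr_sqrtr ?ltW//.
by rewrite mulVf// gt_eqF.
Qed.

Lemma exists_orthogonal_unit (R : realType) (n : nat) (e : 'rV[R]_n.+1) :
  (1 <= n)%N -> exists2 e', dot e' e' = 1 & dot e e' = 0.
Proof.
move=> n1; have : kermx e^T != 0.
  rewrite -mxrank_eq0 mxrank_ker mxrank_tr rank_rV -lt0n.
  by case: (e != 0); rewrite ?subn0 ?subn1.
move=> /rowV0Pn[f /sub_kermxP fe f0].
have [r r0 fr] := exists_unit_multiple f0.
by exists (r *: f) => //; rewrite dotZr dotC /dot fe mxE mulr0.
Qed.

Lemma nbhs_line (R : realType) (m : nat) (A : set 'rV[R]_m) (x v : 'rV[R]_m) :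
  nbhs x A -> exists2 r : R, 0 < r & A (x + r *: v).
Proof.
move=> xA.
have : \forall s \near (0 : R), A (s *: v + x).
  by apply: (@line_continuous _ _ x v A); rewrite /= scale0r add0r.
move=> /nbhs_ballP[d /= d0 dP]; exists (d / 2); first exact: divr_gt0.
rewrite addrC; apply: dP; rewrite -ball_normE/= sub0r normrN gtr0_norm ?divr_gt0//.
by rewrite ltr_pdivrMr// ltr_pMr// ltr1n.
Qed.

(** For a continuous map on a compact space this is the convex hull of the
range, written as the intersection of its supporting halfspaces. In this form
it is governed by the values of linear functionals on the range, which are what
the flow controls. *)
Definition hull {R : realType} {m : nat} {T : Type} (f : T -> 'rV[R]_m) :=
  [set x | forall v, exists y, dot v x <= dot v (f y)].

Lemma norm_le_dot (R : realType) (m : nat) (v : 'rV[R]_m) (r : R) :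
  0 <= r -> dot v v <= r ^+ 2 -> `|v| <= r.
Proof.
move=> r0 vr; rewrite [leLHS]/Num.Def.normr/= mx_normrE.
apply: bigmax_le => // -[i j] _ /=; rewrite ord1.
rewrite -(@ler_pXn2r _ 2)// ?nnegrE// -normrX ger0_norm ?sqr_ge0//.
apply: le_trans vr; rewrite dotE (bigD1 j)//= -expr2 lerDl sumr_ge0// => k _.
by rewrite -expr2 sqr_ge0.
Qed.

Lemma dot_self_continuous (R : realType) (m : nat) :
  continuous (fun v : 'rV[R]_m => dot v v).
Proof.
rewrite (_ : (fun v => _) = fun v : 'rV[R]_m => \sum_(i < m) v 0 i * v 0 i).
  apply: continuous_big => [|i _ v]; first exact: add_continuous.
  have cc : {for v, continuous (fun h : 'rV[R]_m => h 0 i)}.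
    exact: coord_continuous.
  exact: (cvgM cc cc).
by apply/funext => v; rewrite dotE.
Qed.

Lemma dot_sqr_le (R : realType) (m : nat) (v d : 'rV[R]_m) :
  dot v v = 1 -> dot v d ^+ 2 <= dot d d.
Proof.
move=> v1; have := dot_ge0 (d - dot v d *: v).
by rewrite !dotBl !dotBr !dotZl !dotZr v1 (dotC d v) => h; lra.
Qed.

Lemma dot_subZ (R : realType) (m : nat) (v w : 'rV[R]_m) (s : R) :
  dot (v - s *: w) (v - s *: w) =
  dot v v - 2 * s * dot v w + s ^+ 2 * dot w w.
Proof. by rewrite !dotBl !dotBr !dotZl !dotZr (dotC w v); ring. Qed.

Section StrictlyConvexDomain.
Context {R : realType} {m : nat} (A : set 'rV[R]_m).
Hypothesis A_dom : strictly_convex_domain A.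

Lemma domain_compact : compact (closure A).
Proof.
have [_ _ _ Ab _] := A_dom.
apply: bounded_closed_compact; last exact: closed_closure.
have [B [Br AB]] := Ab.
exists B; split => // N BN x xA.
have : closed [set y : 'rV[R]_m | `|y| <= N].
  apply: (@preimage_closed _ _ (fun y : 'rV[R]_m => `|y|) [set r | r <= N]).
    by move=> y _; exact: norm_continuous.
  exact: closed_le.
by move=> /closure_id -> ; apply: closureS xA => y; exact: AB.
Qed.

Lemma domain_convex (x y : 'rV[R]_m) (s : R) :
  closure A x -> closure A y -> 0 <= s <= 1 ->
  closure A ((1 - s) *: x + s *: y).
Proof.
move=> Ax Ay /andP[s0 s1]; have [_ _ _ _ sc] := A_dom.
have [<-|xy] := eqVneq x y; first by rewrite -scalerDl subrK scale1r.
have [->|s0'] := eqVneq s 0; first by rewrite subr0 scale1r scale0r addr0.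
have [->|s1'] := eqVneq s 1; first by rewrite subrr scale1r scale0r add0r.
apply: subset_closure; apply: interior_subset; apply: sc => //.
by rewrite !lt_neqAle s0 s1 s1' eq_sym s0'.
Qed.

Lemma domain_nonempty : closure A !=set0.
Proof. by have [_ [x Ax] _ _ _] := A_dom; exists x; exact: subset_closure. Qed.

Lemma interior_not_max (v x : 'rV[R]_m) : v != 0 -> A° x ->
  exists2 y, closure A y & dot v x < dot v y.
Proof.
move=> v0 /(nbhs_line v)[r r0 Ay].
exists (x + r *: v); first exact: subset_closure.
by rewrite dotDr dotZr ltrDl mulr_gt0// dot_gt0.
Qed.

Lemma boundary_argmax v : v != 0 ->
  exists2 z, boundary A z & forall y, closure A y -> dot v y <= dot v z.
Proof.
move=> v0.
have [z] := compact_EVT_max domain_nonempty domain_compact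
  (continuous_subspaceT (@dot_continuous _ _ v)).
rewrite inE => zA zmax.
have {}zmax y : closure A y -> dot v y <= dot v z.
  by move=> yA; apply: zmax; rewrite inE.
exists z => //; split => // zi.
have [x xA] := interior_not_max v0 zi.
by rewrite ltNge zmax.
Qed.

(** The hyperplane is orthogonal to the segment from [x] to the nearest point of
the closed domain. *)
Lemma domain_separation (x : 'rV[R]_m) : ~ closure A x ->
  exists v c, [/\ v != 0, (forall y, closure A y -> dot v y <= c) & c < dot v x].
Proof.
move=> xA; pose d (y : 'rV[R]_m) := dot (x - y) (x - y).
have dc : continuous d.
  move=> y; have c : {for y, continuous (fun y : 'rV[R]_m => x - y)}.
    exact: (@cvgB _ _ _ (nbhs y) _ (cst x) id _ _ (cvg_cst x) cvg_id).
  exact: continuous_comp c (@dot_self_continuous _ _ _).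
have [y0] := compact_EVT_min domain_nonempty domain_compact
  (continuous_subspaceT dc).
rewrite inE => y0A ymin; pose v := x - y0.
have v0 : v != 0 by apply/eqP => /subr0_eq xy; apply: xA; rewrite xy.
exists v, (dot v y0); split => // [y yA|]; last first.
  by rewrite -subr_gt0 -dotBr; exact: dot_gt0.
rewrite -subr_le0 -dotBr leNgt; apply/negP; set w := y - y0 => pos.
have small s : 0 <= s <= 1 -> 0 <= s ^+ 2 * dot w w - 2 * s * dot v w.
  move=> s01.
  have := ymin ((1 - s) *: y0 + s *: y).
  rewrite inE => /(_ (domain_convex y0A yA s01)).
  rewrite /d (_ : x - (_ + _) = v - s *: w); last first.
    by rewrite /v /w scalerBr scalerBl scale1r !opprD !opprK !addrA addrAC.
  by rewrite -/v dot_subZ => h; lra.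
have ww : 0 < dot w w.
  by apply: dot_gt0; apply: contraTneq pos => ->; rewrite dot0r ltxx.
pose s := Num.min 1 (dot v w / dot w w).
have s0 : 0 < s by rewrite lt_min ltr01/= divr_gt0.
have s1 : s <= 1 by rewrite ge_min lexx.
have sw : s * dot w w <= dot v w.
  by rewrite -ler_pdivlMr// ge_min lexx orbT.
have := small s; rewrite (ltW s0) s1 => /(_ isT).
have h : s * (s * dot w w) <= s * dot v w by rewrite ler_wpM2l// ltW.
have h' : 0 < s * dot v w by exact: mulr_gt0.
by move=> h2; lra.
Qed.

(** The flow controls support functions, while the strict convexity and the
boundary of the body bounded by a slice are known through the domain; with this
equality both can be used on the same set. *)
Lemma hull_boundary (T : Type) (t : T) (f : T -> 'rV[R]_m) :
  range f = boundary A -> hull f = closure A.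
Proof.
move=> fA.
have fcl y : closure A (f y).
  by have : boundary A (f y) by [rewrite -fA; exists y]; case.
apply/seteqP; split=> x.
  move=> xf; apply: contrapT => /domain_separation[v [c [_ vc]]].
  by have [y xy] := xf v; rewrite ltNge (le_trans xy)// vc.
move=> xA v; have [->|v0] := eqVneq v 0.
  by exists t; rewrite !dot0l.
have [z] := boundary_argmax v0; rewrite -fA => -[y _ <-] h.
by exists y; exact: h.
Qed.

End StrictlyConvexDomain.

(** * Consequences of the avoidance principle *)

Section FlowHull.
Context {R : realType} {n : nat} {M : smooth_manifold R n}.
Variable F : M -> R -> 'rV[R]_n.+1.
Hypothesis F_flow : ancient_flow F.
Hypothesis M_compact : compact [set: M].
Hypothesis M_nonempty : [set: M] !=set0.
Hypothesis n_ge1 : (1 <= n)%N.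

Lemma slice_continuous t : t < 0 -> continuous (F^~ t).
Proof.
move=> t0 x.
have c : {for x, continuous (fun x : M => (x, t))}.
  exact: (cvg_pair (@cvg_id _ (nbhs x)) (cvg_cst t)).
exact: (@continuous_comp _ _ _ (fun x => (x, t)) (fun q : M * R => F q.1 q.2)
  x c (flow_continuous F_flow t0)).
Qed.

Lemma slice_argmax v t : t < 0 ->
  exists x, forall y, dot v (F y t) <= dot v (F x t).
Proof.
move=> t0.
have c : continuous (dot v \o F^~ t).
  move=> x; apply: continuous_comp; first exact: slice_continuous.
  exact: dot_continuous.
have [x _ xmax] := compact_EVT_max M_nonempty M_compact (continuous_subspaceT c).
by exists x => y; apply: xmax; rewrite inE.
Qed.

Lemma slice_bounded v t : t < 0 ->
  exists2 B, 0 <= B & forall x, `|dot v (F x t)| <= B.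
Proof.
move=> t0.
have c : continuous (fun x => `|dot v (F x t)|).
  move=> x; apply: (@continuous_comp _ _ _ (dot v \o F^~ t) Num.norm).
    apply: continuous_comp; first exact: slice_continuous.
    exact: dot_continuous.
  exact: norm_continuous.
have [x _ xmax] := compact_EVT_max M_nonempty M_compact (continuous_subspaceT c).
by exists `|dot v (F x t)| => // y; apply: xmax; rewrite inE.
Qed.

(** For a unit vector [v] the halfspace [v.y <= c] is the limit, on bounded sets, of cylinders of
radius [L] with axis at distance [L] inside it: being inside the cylinder of
squared radius [L^2 + Y^2] forces [v.y - c <= Y^2 / (2 L)]. *)
Lemma halfspace_preserved v c t1 t2 : t1 <= t2 -> t2 < 0 ->
  (forall x, dot v (F x t1) <= c) -> forall x, dot v (F x t2) <= c.
Proof.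
move=> t12 t20 init x.
have t10 : t1 < 0 by exact: le_lt_trans t20.
have [v0|v0] := eqVneq v 0.
  by have [y _] := M_nonempty; have := init y; rewrite v0 !dot0l.
have [r r0 v1] := exists_unit_multiple v0.
rewrite leNgt; apply/negP => bad.
have [e' e'1 ve'] := exists_orthogonal_unit (r *: v) n_ge1.
have [B B0 vB] := slice_bounded (r *: v) t10.
have [Y Y0 eY] := slice_bounded e' t10.
pose eta := dot (r *: v) (F x t2) - r * c.
have eta0 : 0 < eta by rewrite /eta dotZl -mulrBr mulr_gt0// subr_gt0.
(* Large enough for the cylinder to contain the slice at [t1] and to exclude
   the assumed point at height [eta] above the hyperplane at [t2]. *)
pose L := B + `|r * c| + Y ^+ 2 / eta + (t2 - t1) + 1.
have q0 : 0 <= Y ^+ 2 / eta by rewrite divr_ge0 ?sqr_ge0// ltW.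
have L1 : 1 <= L by rewrite /L; have := normr_ge0 (r * c); lra.
have LT : t2 - t1 <= L by rewrite /L; have := normr_ge0 (r * c); lra.
have LB : B + `|r * c| <= L by rewrite /L; lra.
have Leta : Y ^+ 2 <= eta * L.
  rewrite mulrC -ler_pdivrMr//; rewrite /L; have := normr_ge0 (r * c); lra.
have LL : L <= L ^+ 2 by rewrite expr2 ler_peMl//; lra.
have init' y : (dot (r *: v) (F y t1) - (r * c - L)) ^+ 2 +
    (dot e' (F y t1) - 0) ^+ 2 <= L ^+ 2 + Y ^+ 2.
  rewrite subr0; apply: lerD.
    rewrite ler_sqr ?nnegrE.
    - have : r * dot v (F y t1) <= r * c by rewrite ler_pM2l.
      rewrite -dotZl; lra.
    - have := vB y; have := ler_norm (r * c); rewrite ler_norml => h /andP[h' _]; lra.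
    - lra.
  rewrite -(real_normK (num_real _)) ler_sqr ?nnegrE//; exact: eY.
have cr : continuous (fun _ : 'rV[R]_n.+1 => -1 : R) by exact: cst_continuous.
have TC : t2 - t1 <= L ^+ 2 + Y ^+ 2 by have := sqr_ge0 Y; lra.
have : (dot (r *: v) (F x t2) - (r * c - L)) ^+ 2 +
    (dot e' (F x t2) - 0) ^+ 2 <= L ^+ 2 + Y ^+ 2 - (t2 - t1).
  apply: (cylinder_barrier F_flow M_compact v1 e'1 ve' cr t12 t20 TC
    (fun y _ => init' y)); last exact: lerN10.
  by move=> y t _ /eqP; rewrite oppr_eq0 oner_eq0.
have -> : dot (r *: v) (F x t2) - (r * c - L) = eta + L by rewrite /eta; ring.
have := sqr_ge0 (dot e' (F x t2) - 0); have := sqr_ge0 Y.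
have : 0 < eta ^+ 2 by rewrite exprn_gt0.
by move: (dot e' _ - 0) Leta t12 => D; lra.
Qed.

Lemma hull_nested t1 t2 : t1 <= t2 -> t2 < 0 ->
  hull (F^~ t2) `<=` hull (F^~ t1).
Proof.
move=> t12 t20 x xt v; have t10 : t1 < 0 by exact: le_lt_trans t20.
have [y ymax] := slice_argmax v t10; have [z xz] := xt v.
by exists y; apply: (le_trans xz); apply: halfspace_preserved ymax _.
Qed.

Lemma range_hull t : range (F^~ t) `<=` hull (F^~ t).
Proof. by move=> _ [x _ <-] v; exists x. Qed.

(** In the plane coordinates [s = e.F - s0], [y = e'.F - y0] the flow stays in
the wedge [|y| <= k s]. The circle of centre [(L, 0)] and radius [L] passes
through the edge, and it covers the cross-section of the wedge at [s = l],
with [l = L / (1 + k^2)], until its squared radius has decreased by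
[T = L l]: at that time it is tangent to the faces. So a flow started at time
[-1 - T] is, at time [-1], either beyond [s = l] or in the shrunk disc, whereas
a fixed point of that last slice is in neither when [L] is large. *)
Lemma no_planar_wedge e e' k s0 y0 : dot e e = 1 -> dot e' e' = 1 ->
  dot e e' = 0 -> 0 < k ->
  ~ forall x t, t < 0 -> `|dot e' (F x t) - y0| <= k * (dot e (F x t) - s0).
Proof.
move=> ee ee' eo k0 wedge; have [x _] := M_nonempty.
pose S := dot e (F x (-1)) - s0.
have m1 : (-1 : R) < 0 by rewrite oppr_lt0.
have s_ge0 y t : t < 0 -> 0 <= dot e (F y t) - s0.
  by move=> t0; rewrite -(pmulr_rge0 _ k0); apply: le_trans (wedge y t t0).
pose q := 1 + k ^+ 2.
have q1 : 1 < q by rewrite /q ltrDl exprn_gt0.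
have q0 : 0 < q by lra.
(* forces [S <= l] and [2 S L < T], hence [(S - L)^2 > L^2 - T] *)
pose L := 2 * S * q + 1 + q * q.
have S0 : 0 <= S by exact: s_ge0.
have Sq : 0 <= S * q by rewrite mulr_ge0// ltW.
have L0 : 0 < L by rewrite /L; have := mulr_gt0 q0 q0; lra.
pose T := L ^+ 2 / q.
have Tq : T * q = L ^+ 2 by rewrite /T divfK// gt_eqF.
have T0 : 0 < T by rewrite divr_gt0// exprn_gt0.
pose l := L / q.
have lq : l * q = L by rewrite /l divfK// gt_eqF.
have l0 : 0 < l by rewrite divr_gt0.
have TlL : T = l * L by rewrite /T /l expr2 mulrAC.
have lL : l <= L by rewrite -lq ler_peMr// ltW.
have rhoc : continuous (fun y : 'rV[R]_n.+1 => dot e y - (s0 + l)).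
  exact: dist_dot_continuous.
have ysq y t : t < 0 ->
    (dot e' (F y t) - y0) ^+ 2 <= k ^+ 2 * (dot e (F y t) - s0) ^+ 2.
  move=> t0; rewrite -(real_normK (num_real _)) -exprMn ler_sqr ?nnegrE//.
    exact: wedge.
  by rewrite mulr_ge0 ?s_ge0// ltW.
have : (dot e (F x (-1)) - (s0 + L)) ^+ 2 + (dot e' (F x (-1)) - y0) ^+ 2
    <= L ^+ 2 - (-1 - (-1 - T)).
  apply: (cylinder_barrier F_flow M_compact ee ee' eo rhoc).
  - by rewrite gerBl ltW.
  - by [].
  - by rewrite opprB addrCA subrr addr0 TlL expr2 ler_wpM2r// ltW.
  - move=> y; have t0 : -1 - T < 0 by lra.
    have := s_ge0 y _ t0; have := ysq y _ t0.
    move: (dot e _) (dot e' _) => a b h1 h2 h3.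
    have h4 : (a - s0) * ((a - s0) * q) <= (a - s0) * L.
      apply: ler_wpM2l => //; rewrite -lq; apply: ler_wpM2r; [exact: ltW|lra].
    have h5 : 0 <= (a - s0) * L by rewrite mulr_ge0// ltW.
    move: h4; rewrite /q; move: h1 h5; clear; lra.
  - move=> y t /andP[t1 t2] /eqP; rewrite subr_eq0 => /eqP h.
    have t0 : t < 0 by exact: le_lt_trans m1.
    have := ysq y _ t0; rewrite h.
    have -> : s0 + l - s0 = l by ring.
    have h2 : l * (l * q) = T by rewrite lq TlL.
    move: h2; rewrite /q; move: TlL t2 t1 (dot e' _); clear; move=> *; lra.
  - have : S * q <= l * q by rewrite lq /L; have := mulr_gt0 q0 q0; lra.
    rewrite ler_pM2r// /S; lra.
have -> : dot e (F x (-1)) - (s0 + L) = S - L by rewrite /S; ring.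
have := sqr_ge0 (dot e' (F x (-1)) - y0); move: (_ - y0) => D.
have : 2 * S * L < T.
  rewrite TlL ltr_pM2r//; rewrite -(ltr_pM2r q0) lq /L.
  have := mulr_gt0 q0 q0; lra.
have := sqr_ge0 S.
move: T0; clear; lra.
Qed.

End FlowHull.

(** * The set of reach *)

Section Reach.
Context {R : realType} {n : nat} {M : smooth_manifold R n}.
Variable F : M -> R -> 'rV[R]_n.+1.
Hypothesis F_conv : convex_ancient_flow F.
Hypothesis M_compact : compact [set: M].
Hypothesis M_nonempty : [set: M] !=set0.
Hypothesis n_ge1 : (1 <= n)%N.

Let F_flow : ancient_flow F. Proof. by case: F_conv. Qed.

Lemma slice_domain t : t < 0 -> exists A, [/\ strictly_convex_domain A,
  range (F^~ t) = boundary A & hull (F^~ t) = closure A].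
Proof.
move=> t0; have [_ /(_ t t0)[_ [A [Ad fA]]]] := F_conv.
have [x _] := M_nonempty.
by exists A; split => //; exact: hull_boundary fA.
Qed.

(** The bisector [- (v + w)] and the difference [v - w] of two unit normals are
orthogonal, which reduces a wedge to the symmetric planar one. *)
Lemma no_wedge v w a b : dot v v = 1 -> dot w w = 1 -> w != v -> w != - v ->
  (forall x t, t < 0 -> dot v (F x t) <= a) ->
  (forall x t, t < 0 -> dot w (F x t) <= b) -> False.
Proof.
move=> v1 w1 wv wNv va wb.
have P0 : v + w != 0 by rewrite addrC addr_eq0.
have Q0 : v - w != 0 by rewrite subr_eq0 eq_sym.
have [r r0 e1] := exists_unit_multiple P0.
have [r' r'0 e'1] := exists_unit_multiple Q0.
apply: (@no_planar_wedge _ _ _ F F_flow M_compact M_nonempty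
  (- r *: (v + w)) (r' *: (v - w)) (r' / r) (- (a + b) * r) ((a - b) * r')) => //.
- by rewrite scaleNr dotNl dotNr opprK.
- rewrite dotZl dotZr dotDl !dotBr v1 w1 (dotC w v); ring.
- exact: divr_gt0.
move=> x t t0; rewrite !dotZl !dotDl dotNl.
have -> : r' / r * (- r * (dot v (F x t) + dot w (F x t)) - - (a + b) * r) =
  r' * (a + b - (dot v (F x t) + dot w (F x t))) by field; rewrite gt_eqF.
have := va x t t0; have := wb x t t0.
move: (dot v _) (dot w _) => V W hW hV.
have -> : r' * (V - W) - (a - b) * r' = r' * (V - W - (a - b)) by ring.
rewrite normrM gtr0_norm// ler_pM2l// ler_norml; lra.
Qed.

Lemma slice_below_near v c (t : R) : t < 0 -> (forall x, dot v (F x t) < c) ->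
  \forall r \near t, forall x, dot v (F x r) < c.
Proof.
move=> t0 tc.
have := (compact_near_coveringP _).1 M_compact R (nbhs t)
  (fun r x => dot v (F x r) < c) _.
case=> [x _|d /= d0 dP].
  have c1 : {for (x, t), continuous (dot v \o (fun q : M * R => F q.1 q.2))}.
    by apply: continuous_comp; [exact: flow_continuous|exact: dot_continuous].
  apply: (c1 [set r | r < c]).
  by apply: open_nbhs_nbhs; split; [exact: open_lt|exact: tc].
by exists d => // r /dP h x; exact: h.
Qed.

(** Uniformity in the point of the slice controls all support functions at
once. *)
Lemma slice_uniform (t e : R) : t < 0 -> 0 < e ->
  \forall r \near t, forall x, dot (F x r - F x t) (F x r - F x t) < e.
Proof.
move=> t0 e0.
have := (compact_near_coveringP _).1 M_compact R (nbhs t)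
  (fun r x => dot (F x r - F x t) (F x r - F x t) < e) _.
case=> [x _|d /= d0 dP].
  have c1 := flow_continuous F_flow t0 (x := x).
  have c2 : {for (x, t), continuous (fun q : M * R => F q.1 t)}.
    apply: (@continuous_comp _ _ _ fst (F^~ t) (x, t)); first exact: cvg_fst.
    exact: slice_continuous.
  have c3 : {for (x, t), continuous (fun q : M * R => F q.1 q.2 - F q.1 t)}.
    exact: (@cvgB _ _ _ (nbhs (x, t)) _ _ _ _ _ c1 c2).
  have c4 := continuous_comp c3 (@dot_self_continuous _ _ _).
  apply: (c4 [set r | r < e]).
  apply: open_nbhs_nbhs; split; first exact: open_lt.
  by rewrite /= subrr dot0r.
by exists d => // r /dP h x; exact: h.
Qed.

Variable p : 'rV[R]_n.+1.
Hypothesis F_extinct : extinct_at F p.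

Lemma extinct_halfspace v c : dot v p < c ->
  exists2 d, 0 < d & forall t x, - d < t -> t < 0 -> dot v (F x t) < c.
Proof.
move=> vp; have : nbhs p [set y | dot v y < c].
  apply: (@dot_continuous _ _ v p [set r | r < c]).
  by apply: open_nbhs_nbhs; split; first exact: open_lt.
move=> /nbhs_ballP[r /= r0 rP].
have [d /= d0 dP] := F_extinct r0.
exists d => // t x td t0; apply: rP.
have td' : ball_ Num.norm 0 d t by rewrite /ball_/= sub0r normrN ltr0_norm// ltrNl.
by apply: (dP t td' t0 (F x t)); exists x.
Qed.

Lemma extinct_hull t : t < 0 -> hull (F^~ t) p.
Proof.
move=> t0 v; apply: contrapT => np.
have [x xmax] := slice_argmax F_flow M_compact M_nonempty v t0.
have vp : dot (- v) p < - dot v (F x t).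
  by rewrite dotNl ltrN2 ltNge; apply/negP => h; apply: np; exists x.
have [d d0 dP] := extinct_halfspace vp.
pose s := Num.max t (- d / 2).
have s0 : s < 0 by rewrite /s gt_max t0; lra.
have ds : - d < s by rewrite /s lt_max; apply/orP; right; lra.
have := dP s x ds s0; rewrite dotNl ltrN2 ltNge.
rewrite (halfspace_preserved F_flow M_compact M_nonempty n_ge1 _ s0 xmax)//.
by rewrite /s le_max lexx.
Qed.

(** Let [u] be the last time at which the body contains [x]; it is negative
since the bodies shrink to a point other than [x]. The body at time [u] still
contains [x], because a strict separation persists for nearby times. If [x] were
interior at time [u], every support function would exceed its value at [x] by a
definite amount, which persists for slightly later times. So [x] is on the
boundary, which is the slice. *)
Lemma hull_reached s x : s < 0 -> hull (F^~ s) x -> x != p ->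
  exists y t, t < 0 /\ F y t = x.
Proof.
move=> s0 xs xp; apply: contrapT => nreach.
have {}nreach t y : t < 0 -> F y t <> x by move=> t0 E; apply: nreach; exists y, t.
pose w := x - p.
have wp : dot w p < dot w x.
  by rewrite -subr_gt0 -dotBr dot_gt0// subr_eq0.
have [d d0 dP] := extinct_halfspace wp.
pose T := [set t | [/\ s <= t, t < 0 & hull (F^~ t) x]].
have Td t : T t -> t <= - d.
  move=> [st t0 /(_ w)[y]]; apply: contraLR; rewrite -!ltNge => dt.
  exact: dP.
have Ts : T s by split.
have supT : has_sup T by split; [exists s|exists (- d) => t; exact: Td].
pose u := sup T.
have ud : u <= - d by apply: ge_sup; [exists s|exact: Td].
have su : s <= u by apply: sup_upper_bound.
have u0 : u < 0 by lra.
have xu : hull (F^~ u) x.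
  move=> v; apply: contrapT => nv.
  have {}nv y : dot v (F y u) < dot v x.
    by rewrite ltNge; apply/negP => h; apply: nv; exists y.
  have [r /= r0 rP] := slice_below_near u0 nv.
  have [t [st t0 tx] ut] := sup_adherent r0 supT.
  have [y] := tx v; apply/negP; rewrite -ltNge; apply: rP.
  have tu : t <= u by exact: sup_upper_bound.
  rewrite /ball_/= ger0_norm ?subr_ge0//.
  by rewrite -/u in ut; lra.
have [A [Ad fA hA]] := slice_domain u0.
have xA : A° x.
  apply: contrapT => nxA.
  have : range (F^~ u) x by rewrite fA; split => //; rewrite -hA.
  by move=> [y _]; exact: nreach.
have [r /= r0 rP] : exists2 r : R, 0 < r &
    forall v, dot v v = 1 -> closure A (x + r *: v).
  move: xA => /nbhs_ballP[r /= r0 rP]; exists (r / 2); first exact: divr_gt0.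
  move=> v v1; apply: subset_closure; apply: rP.
  rewrite -ball_normE/= opprD addrA subrr sub0r normrN normrZ.
  rewrite gtr0_norm ?divr_gt0//.
  have : `|v| <= 1 by apply: norm_le_dot => //; rewrite v1 expr1n.
  by move=> ?; rewrite (@le_lt_trans _ _ (r / 2 * 1)) ?ler_wpM2l//; lra.
have [q /= q0 qP] := slice_uniform u0 (exprn_gt0 2 r0).
pose t := Num.min (u + q / 2) (u / 2).
have t0 : t < 0 by rewrite /t gt_min; apply/orP; right; lra.
have ut : u < t by rewrite /t lt_min; apply/andP; split; lra.
have tq : t - u < q.
  have : t <= u + q / 2 by rewrite /t ge_min lexx.
  lra.
have nxt : ~ hull (F^~ t) x.
  move=> xt; have : t <= u by apply: sup_upper_bound => //; split => //; lra.
  by rewrite leNgt ut.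
apply: nxt => v; have [->|v0] := eqVneq v 0.
  by have [y _] := M_nonempty; exists y; rewrite !dot0l.
have [k k0 v1] := exists_unit_multiple v0.
have : hull (F^~ u) (x + r *: (k *: v)) by rewrite hA; exact: rP.
move=> /(_ (k *: v))[y]; rewrite dotDr dotZr v1 mulr1 => h.
exists y; rewrite -(ler_pM2l k0) -!dotZl.
have := qP t _ y; rewrite /ball_/= ltr0_norm ?subr_lt0// opprB => /(_ tq).
move=> /(le_lt_trans (dot_sqr_le (F y t - F y u) v1)).
rewrite -[X in X < _](real_normK (num_real _)) ltr_sqr ?nnegrE//; last exact: ltW.
by rewrite dotBr ltr_norml => /andP[+ _]; lra.
Qed.

(** Suppose that [v] attains at [x] its maximum over all bodies. Then [x] is on
the slice at time [t] and belongs to the body at time [t - 1], which by strict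
convexity meets the hyperplane [v.y = v.x] in [x] only. The cylinder of squared
radius [L^2 + 1/4] with axis at depth [L] below [x] is allowed to shrink in
the strip [|e'.(y - x)| <= 1/2]: on the sides of the strip the body lies at
depth at least [d], which for large [L] leaves room for a decrease by 1. As
[1 > 1/4], the point [x] is outside the cylinder at time [t]. *)
Lemma support_not_attained v t x : v != 0 -> t < 0 -> hull (F^~ t) x ->
  exists s y, [/\ s < 0, hull (F^~ s) y & dot v x < dot v y].
Proof.
move=> v0 t0 xt; apply: contrapT => nex.
have [r r0 v1] := exists_unit_multiple v0.
set w := r *: v in v1.
have {nex}xmax s y : s < 0 -> hull (F^~ s) y -> dot w y <= dot w x.
  move=> s0 ys; rewrite !dotZl ler_pM2l// leNgt; apply/negP => h.
  by apply: nex; exists s, y.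
have [A [Ad fA hA]] := slice_domain t0.
have [z zt] : exists z, F z t = x.
  have : range (F^~ t) x.
    rewrite fA; split; first by rewrite -hA.
    move=> /(interior_not_max v0)[y]; rewrite -hA => yt xy.
    by have := xmax _ _ t0 yt; rewrite !dotZl ler_pM2l// leNgt xy.
  by move=> [z _ <-]; exists z.
have {}z_hull s : s <= t -> hull (F^~ s) x.
  by move=> st; exact: (hull_nested F_flow M_compact M_nonempty n_ge1 st t0).
have s0 : t - 1 < 0 by lra.
have st : t - 1 <= t by lra.
have [e' e'1 ve'] := exists_orthogonal_unit w n_ge1.
have [B [Bd fB hB]] := slice_domain s0.
(* the depth of the body below the hyperplane along the sides of the strip *)
have gap : exists2 d, 0 < d <= 1 & forall y, closure B y ->
    (dot e' y - dot e' x) ^+ 2 = 4^-1 -> dot w y <= dot w x - d.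
  pose S := closure B `&` [set y | (dot e' y - dot e' x) ^+ 2 = 4^-1].
  have Sc : compact S.
    apply: compact_closedI; first exact: domain_compact.
    apply: (@preimage_closed _ _ (fun y => (dot e' y - dot e' x) ^+ 2) [set 4^-1]).
      by move=> y _; exact: sqr_dist_dot_continuous.
    exact: closed_eq.
  have [S0|/set0P/negP/negPn/eqP S0] := pselect (S !=set0); last first.
    exists 1; first by rewrite ltr01 lexx.
    by move=> y yB ye; have : S y by []; rewrite S0.
  have [y] := compact_EVT_max S0 Sc
    (continuous_subspaceT (@dot_continuous _ _ w)).
  rewrite inE => -[yB /= ye] ymax.
  have yx : dot w y < dot w x.
    rewrite ltNge; apply/negP => h.
    have xy : x != y.
      apply/eqP => xy; move: ye; rewrite -xy subrr expr0n/= => /eqP.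
      by rewrite eq_sym invr_eq0 pnatr_eq0.
    have xB : closure B x by rewrite -hB; exact: z_hull.
    have [_ _ _ _ sc] := Bd.
    have half : 0 < (2^-1 : R) < 1 by apply/andP; split; lra.
    have w0 : w != 0 by rewrite -dot_eq0 v1 oner_eq0.
    have [y'] := interior_not_max w0 (sc x y 2^-1 xB yB xy half).
    rewrite -hB => y'B; have := xmax _ _ s0 y'B.
    rewrite dotDr !dotZr; lra.
  exists (Num.min 1 (dot w x - dot w y)).
    by rewrite lt_min ltr01 subr_gt0 yx ge_min lexx.
  move=> y' y'B y'e; have h : dot w y' <= dot w y by apply: ymax; rewrite inE.
  have : Num.min 1 (dot w x - dot w y) <= dot w x - dot w y.
    by rewrite ge_min lexx orbT.
  lra.
have {gap}[d /andP[d0 d1] gap] := gap.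
have [C C0 wC] := slice_bounded F_flow M_compact M_nonempty w s0.
have low y q : t - 1 <= q -> q <= t -> - C <= dot w (F y q).
  move=> sq qt; rewrite lerNl -dotNl.
  apply: (halfspace_preserved F_flow M_compact M_nonempty n_ge1 sq).
    exact: le_lt_trans t0.
  by move=> y'; rewrite dotNl; have := wC y'; rewrite ler_norml lerNl => /andP[].
pose L := C + `|dot w x| + d^-1 + 1.
have di : 1 <= d^-1 by rewrite invf_ge1.
have L1 : 1 <= L by rewrite /L; have := normr_ge0 (dot w x); lra.
have LC : C + dot w x <= L - 1.
  by rewrite /L; have := ler_norm (dot w x); lra.
have Ld : 1 <= L * d.
  rewrite -ler_pdivrMr// mul1r /L; have := normr_ge0 (dot w x); lra.
have LL : 1 <= L ^+ 2 by rewrite -(expr1n _ 2) ler_sqr ?nnegrE; lra.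
have rhoc : continuous (fun y => (dot e' y - dot e' x) ^+ 2 - 4^-1).
  move=> y; apply: (@cvgB _ _ _ (nbhs y) _ (fun y => (dot e' y - dot e' x) ^+ 2)
     (cst 4^-1)); last exact: cvg_cst.
  exact: sqr_dist_dot_continuous.
have : (dot w (F z t) - (dot w x - L)) ^+ 2 + (dot e' (F z t) - dot e' x) ^+ 2
   <= L ^+ 2 + 4^-1 - (t - (t - 1)).
  apply: (cylinder_barrier F_flow M_compact v1 e'1 ve' rhoc) => //.
  - lra.
  - move=> y; have := low y _ (lexx _) st.
    have := xmax _ _ s0 (range_hull (imageT (F^~ (t - 1)) y)).
    move: (dot w (F _ _)) => a h1 h2 h3.
    have : (a - (dot w x - L)) ^+ 2 <= L ^+ 2 by rewrite ler_sqr ?nnegrE; lra.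
    lra.
  - move=> y q /andP[sq qt] /eqP; rewrite subr_eq0 => /eqP ye.
    have q0 : q < 0 by exact: le_lt_trans t0.
    have yB : closure B (F y q).
      rewrite -hB; apply: (hull_nested F_flow M_compact M_nonempty n_ge1 sq q0).
      exact: range_hull (imageT _ _).
    have := gap _ yB ye; have := low y _ sq qt; rewrite ye.
    move: (dot w (F _ _)) => a h1 h2.
    have : (a - (dot w x - L)) ^+ 2 <= (L - d) ^+ 2 by rewrite ler_sqr ?nnegrE; lra.
    have : d ^+ 2 <= 1 by rewrite -[leRHS](expr1n _ 2) ler_sqr ?nnegrE; lra.
    lra.
  - rewrite zt subrr expr0n/=; lra.
rewrite zt subrr expr0n/=; have -> : dot w x - (dot w x - L) = L by ring.
lra.
Qed.

(** The unit normals separating [x] from the body at time [t] form a decreasing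
family of nonempty closed sets as [t] goes to minus infinity, so they have a
common element by compactness of the sphere. *)
Lemma unreached_separation x : (forall t, t < 0 -> ~ hull (F^~ t) x) ->
  exists2 v, dot v v = 1 &
    forall t y, t < 0 -> hull (F^~ t) y -> dot v y <= dot v x.
Proof.
move=> nx.
pose S := [set v : 'rV[R]_n.+1 | dot v v = 1].
have Sc : compact S.
  apply: bounded_closed_compact.
    exists 1; split => // r r1 v vS /=.
    apply: (@le_trans _ _ 1); last exact: ltW.
    by apply: norm_le_dot => //; rewrite vS expr1n.
  apply: (@preimage_closed _ _ (fun v : 'rV[R]_n.+1 => dot v v) [set 1]).
    by move=> v _; exact: dot_self_continuous.
  exact: closed_eq.
apply: contrapT => nex.
have := (compact_near_coveringP _).1 Sc R (ninfty_nbhs R)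
  (fun t v => t < 0 -> exists y, dot v x < dot v (F y t)) _.
case=> [v v1|N [_ NP]].
  have [t [y [t0 yv]]] : exists t y, t < 0 /\ dot v x < dot v (F y t).
    apply: contrapT => h; apply: nex; exists v => // t y t0 yt.
    rewrite leNgt; apply/negP => xy; apply: h.
    by have [z yz] := yt v; exists t, z; split => //; exact: lt_le_trans yz.
  have nv : \forall v' \near v, 0 < dot v' (F y t - x).
    have : nbhs v (dot (F y t - x) @^-1` [set r | 0 < r]).
      apply: (@dot_continuous _ _ (F y t - x) v).
      apply: open_nbhs_nbhs; split; first exact: open_gt.
      by rewrite /= dotC dotBr subr_gt0.
    by apply: filterS => v' /=; rewrite dotC.
  exists ([set v' | 0 < dot v' (F y t - x)], [set s | s < t]).
    by split => //; exists t; split; first exact: num_real.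
  move=> [v' s] /= [v'y st] s0.
  apply: contrapT => h.
  have : dot v' (F y t) <= dot v' x.
    apply: (halfspace_preserved F_flow M_compact M_nonempty n_ge1 (ltW st) t0).
    by move=> z; rewrite leNgt; apply/negP => hz; apply: h; exists z.
  by rewrite leNgt -subr_gt0 -dotBr v'y.
pose t := Num.min (N - 1) (-1).
have t0 : t < 0 by rewrite /t gt_min ltrN10 orbT.
have tN : t < N by rewrite /t gt_min; apply/orP; left; lra.
apply: (nx t t0) => v; have [->|v0] := eqVneq v 0.
  by have [y _] := M_nonempty; exists y; rewrite !dot0l.
have [k k0 v1] := exists_unit_multiple v0.
have [y] := NP t tN _ v1 t0.
by rewrite !dotZl ltr_pM2l// => /ltW; exists y.
Qed.

End Reach.

(** * The trichotomy *)

Theorem corollary7 (R : realType) (n : nat) (n_ge1 : (1 <= n)%N)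
  (M : smooth_manifold R n)
  (M_nonempty : [set: M] !=set0)
  (M_connected : connected [set: M])
  (M_compact : compact [set: M])
  (F : M -> R -> 'rV[R]_n.+1)
  (F_flow : convex_ancient_flow F)
  (p : 'rV[R]_n.+1)
  (F_extinct : extinct_at F p) :
  is_slab (set_of_reach F `|` [set p]) \/
  is_halfspace (set_of_reach F `|` [set p]) \/
  set_of_reach F `|` [set p] = [set: 'rV[R]_n.+1].
Proof.
set U := _ `|` _.
have [F_anc _] := F_flow.
have UE x : U x <-> exists2 t, t < 0 & hull (F^~ t) x.
  split=> [[[t /= t0 xt]|->]|[t t0 xt]].
  - rewrite in_itv/= in t0; exists t => //; exact: range_hull xt.
  - exists (-1); first exact: ltrN10.
    exact: (extinct_hull F_flow M_compact M_nonempty n_ge1 F_extinct).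
  - have [->|xp] := eqVneq x p; first by right.
    have [y [s [s0 <-]]] :=
      hull_reached F_flow M_compact M_nonempty F_extinct t0 xt xp.
    by left; exists s; [rewrite /= in_itv|exists y].
have Unot_max v x : v != 0 -> U x -> exists2 y, U y & dot v x < dot v y.
  move=> v0 /UE[t t0 xt].
  have [s [y [s0 ys xy]]] :=
    support_not_attained F_flow M_compact M_nonempty n_ge1 v0 t0 xt.
  by exists y => //; apply/UE; exists s.
have Usep x : ~ U x ->
    exists2 v, dot v v = 1 & forall y, U y -> dot v y <= dot v x.
  move=> nx.
  have [|v v1 vx] := unreached_separation F_flow M_compact M_nonempty n_ge1 (x := x).
    by move=> t t0 xt; apply: nx; apply/UE; exists t.
  by exists v => // y /UE[t t0 yt]; exact: vx t0 yt.
have [->|/eqP UT] := pselect (U = setT); first by right; right.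
have [x nUx] : exists x, ~ U x.
  apply: contrapT => h; move: UT => /eqP; apply; apply/seteqP; split=> // x _.
  by apply: contrapT => nx; apply: h; exists x.
have [v v1 vx] := Usep x nUx.
have v0 : v != 0 by rewrite -dot_eq0 v1 oner_eq0.
have nv0 : - v != 0 by rewrite oppr_eq0.
have Up : U p by right.
have parallel w y : dot w w = 1 -> (forall u, U u -> dot w u <= dot w y) ->
    w = v \/ w = - v.
  move=> w1 wy; apply: contrapT => h.
  have UF z t : t < 0 -> U (F z t).
    by move=> t0; apply/UE; exists t => // u; exists z.
  apply: (no_wedge F_flow M_compact M_nonempty (v := v) (w := w)
    (a := dot v x) (b := dot w y)) => //.
  - by apply/eqP => e; apply: h; left.
  - by apply/eqP => e; apply: h; right.
  - by move=> z t t0; apply/vx/UF.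
  - by move=> z t t0; apply/wy/UF.
pose V := [set dot v y | y in U].
have V0 : V !=set0 by exists (dot v p), p.
have Vub : has_ubound V by exists (dot v x) => _ [y Uy <-]; exact: vx.
have lt_sup y : U y -> dot v y < sup V.
  move=> /(Unot_max v y v0)[z Uz yz]; apply: (lt_le_trans yz).
  by apply: ub_le_sup => //; exists z.
have beyond y : dot v y < sup V -> ~ (forall u, U u -> dot v u <= dot v y).
  move=> ya h; have : sup V <= dot v y.
    by apply: ge_sup => // _ [u Uu <-]; exact: h.
  by rewrite leNgt ya.
have below y : dot v y < sup V -> ~ U y -> forall u, U u -> dot v y <= dot v u.
  move=> ya nUy; have [w w1 wy] := Usep y nUy.
  have [wv|wv] := parallel w y w1 wy.
    by case: (beyond y ya) => u Uu; rewrite -wv; exact: wy.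
  by move=> u Uu; have := wy u Uu; rewrite wv !dotNl lerN2.
have [Vlb|Vlb] := pselect (has_lbound V); [left|right; left].
  have inf_lt y : U y -> inf V < dot v y.
    move=> /(Unot_max (- v) y nv0)[z Uz]; rewrite !dotNl ltrN2; apply: le_lt_trans.
    by apply: ge_inf => //; exists z.
  exists v, (inf V), (sup V); split => //.
    exact: lt_trans (inf_lt p Up) (lt_sup p Up).
  left; apply/seteqP; split=> [y Uy /=|y /= /andP[yb ya]].
    by rewrite inf_lt// lt_sup.
  apply: contrapT => nUy; move: yb; apply/negP; rewrite -leNgt.
  by apply: lb_le_inf => // _ [u Uu <-]; exact: below.
exists v, (sup V); split => //.
left; apply/seteqP; split=> [y Uy /=|y /= ya]; first exact: lt_sup.
apply: contrapT => nUy; apply: Vlb.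
by exists (dot v y) => _ [u Uu <-]; exact: below.
Qed.
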